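(* Let $M$ be a compact, oriented sRC-manifold. Suppose $M$ is $H$-normal, $VM$ is integrable, and the rank of $HM$ is even. If every horizontal sectional curvature of $M$ is positive, then every $H$-Killing field $K$ is vertical at some point $p\in M$, i.e. $(K_H)_p=0$ for some $p\in M$.
   Context: A sub-Riemannian manifold is a smooth manifold $M$ with a smooth bracket-generating subbundle $HM\subseteq TM$ and a smooth inner product $\langle\cdot,\cdot\rangle$ on $HM$. An sRC-manifold is a sub-Riemannian manifold together with a smooth subbundle $VM$ such that $TM=HM\oplus VM$. Subscripts $H$, $V$ denote the projections. A smooth vector field $K$ is an $H$-Killing field if $[K,HM]\subset HM$, $[K,VM]\subset VM$ (brackets with sections) and $K\langle X,Y\rangle=\langle[K,X],Y\rangle+\langle X,[K,Y]\rangle$ for all sections $X,Y$ of $HM$. Fix a Riemannian metric $g$ extending $\langle\cdot,\cdot\rangle$ with $HM\perp VM$. The canonical connection $\nabla$ is the unique connection that is compatible with $g$, makes $HM$ and $VM$ parallel, and whose torsion $\mathrm{Tor}(A,B)=\nabla_AB-\nabla_BA-[A,B]$ satisfies $\mathrm{Tor}(HM,HM)\subseteq VM$, $\mathrm{Tor}(VM,VM)\subseteq HM$, and $g(\mathrm{Tor}(Z,X),Y)=g(\mathrm{Tor}(Z,Y),X)$ whenever $X,Y$ lie in one of $HM,VM$ and $Z$ lies in the other. For horizontal $X$, $\nabla X$ is independent of $g$. $M$ is $H$-normal if $\mathrm{Tor}(HM,VM)\subseteq VM$ (independent of $g$). Curvature: $R(A,B)C=(\nabla_A\nabla_B-\nabla_B\nabla_A-\nabla_{[A,B]})C$.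 Horizontal sectional curvatures are positive if $\langle R(X,Y)Y,X\rangle>0$ for all $q\in M$ and all linearly independent $X,Y\in H_qM$. *)

(* Defs.v *)
From HB Require Import structures.
From mathcomp Require Import all_boot all_order all_algebra.
From mathcomp Require Import all_classical all_reals all_analysis.
Set Implicit Arguments. Unset Strict Implicit. Unset Printing Implicit Defensive.
Import Order.TTheory GRing.Theory Num.Theory.
Import numFieldNormedType.Exports.
Local Open Scope classical_set_scope.
Local Open Scope ring_scope.

(* Differentiability of class C^k on an open set U of R^n: all iterated
   directional derivatives of order at most k exist and are continuous on U. *)
Fixpoint Ck (R : realType) (n k : nat) (U : set 'rV[R]_n) (f : 'rV[R]_n -> R)
    : Prop :=
  (forall x, U x -> {for x, continuous f}) /\
  (if k is k'.+1 then
    (forall x v, U x -> derivable f x v) /\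
    (forall v, Ck k' U (fun x => 'D_v f x))
   else True).

Definition smooth_on (R : realType) (n : nat) (U : set 'rV[R]_n)
    (f : 'rV[R]_n -> R) : Prop := forall k, Ck k U f.

Definition smooth_map_on (R : realType) (n m : nat) (U : set 'rV[R]_n)
    (f : 'rV[R]_n -> 'rV[R]_m) : Prop :=
  forall j, smooth_on U (fun x => f x 0 j).

Section CkTheory.
Context {R : realType} {n : nat}.
Implicit Types (U : set 'rV[R]_n) (f g : 'rV[R]_n -> R).

Lemma open_near_eq U f g x : open U -> (forall y, U y -> f y = g y) -> U x ->
  \forall y \near x, f y = g y.
Proof.
move=> oU fg Ux; have : nbhs x U by apply: open_nbhs_nbhs.
exact: filterS.
Qed.

Lemma continuous_ext U f g x : open U -> (forall y, U y -> f y = g y) -> U x ->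
  {for x, continuous f} -> {for x, continuous g}.
Proof.
move=> oU fg Ux; rewrite /prop_for /continuous_at -(fg x Ux).
apply: cvg_trans; apply: (@near_eq_cvg _ _ (nbhs x)).
by apply: (open_near_eq oU _ Ux) => y Uy; rewrite fg.
Qed.

Lemma Ck_ext k U f g : open U -> (forall x, U x -> f x = g x) ->
  Ck k U f -> Ck k U g.
Proof.
move=> oU; elim: k f g => [|k IH] f g fg.
  by move=> [cf _]; split=> // x Ux; apply: (continuous_ext oU fg Ux); exact: cf.
move=> [cf [df Df]]; split.
  by move=> x Ux; apply: (continuous_ext oU fg Ux); exact: cf.
split=> [x v Ux|v].
  by apply: (near_eq_derivable (open_near_eq oU fg Ux)); exact: df.
apply: IH (Df v) => x Ux.
exact: (near_eq_derive _ (open_near_eq oU fg Ux)).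
Qed.

Lemma CkW k U f : Ck k.+1 U f -> Ck k U f.
Proof.
elim: k f => [|k IH] f [cf [df Df]]; split=> //; split=> // v; apply: IH.
exact: Df.
Qed.

Lemma Ck_cst k U (a : R) : open U -> Ck k U (cst a).
Proof.
move=> oU; elim: k a => [|k IH] a; split => //; try by move=> x _; exact: cst_continuous.
split=> [x v _|v]; first exact: derivable_cst.
by apply: (Ck_ext oU _ (IH 0)) => x _; rewrite derive_cst.
Qed.

Lemma CkN k U f : open U -> Ck k U f -> Ck k U (\- f).
Proof.
move=> oU; elim: k f => [|k IH] f.
  by move=> [cf _]; split => // x Ux; apply: continuousN; exact: cf.
move=> [cf [df Df]]; split; first by move=> x Ux; apply: continuousN; exact: cf.
split=> [x v Ux|v]; first by apply: derivableN; exact: df.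
apply: (Ck_ext oU _ (IH _ (Df v))) => x Ux /=.
by rewrite (deriveN (df x v Ux)).
Qed.

Lemma CkD k U f g : open U -> Ck k U f -> Ck k U g -> Ck k U (f \+ g).
Proof.
move=> oU; elim: k f g => [|k IH] f g.
  move=> [cf _] [cg _]; split => // x Ux.
  by apply: continuousD; [exact: cf|exact: cg].
move=> [cf [df Df]] [cg [dg Dg]]; split.
  by move=> x Ux; apply: continuousD; [exact: cf|exact: cg].
split=> [x v Ux|v]; first by apply: derivableD; [exact: df|exact: dg].
apply: (Ck_ext oU _ (IH _ _ (Df v) (Dg v))) => x Ux /=.
by rewrite (deriveD (df x v Ux) (dg x v Ux)).
Qed.

Lemma CkM k U f g : open U -> Ck k U f -> Ck k U g -> Ck k U (f \* g).
Proof.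
move=> oU; elim: k f g => [|k IH] f g.
  move=> [cf _] [cg _]; split => // x Ux.
  by apply: continuousM; [exact: cf|exact: cg].
move=> cf' cg'; have := CkW cf'; have := CkW cg' => kg kf.
move: cf' cg' => [cf [df Df]] [cg [dg Dg]]; split.
  by move=> x Ux; apply: continuousM; [exact: cf|exact: cg].
split=> [x v Ux|v]; first by apply: derivableM; [exact: df|exact: dg].
apply: (Ck_ext oU _ (CkD oU (IH _ _ kf (Dg v)) (IH _ _ kg (Df v)))) => x Ux /=.
by rewrite (deriveM (df x v Ux) (dg x v Ux)).
Qed.

End CkTheory.

(* A chart of dimension n; the values of chart_map outside chart_dom and of
   chart_inv outside chart_img are irrelevant. *)
Record chart (R : realType) (n : nat) (T : topologicalType) := Chart {
  chart_dom : set T;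
  chart_img : set 'rV[R]_n;
  chart_map : T -> 'rV[R]_n;
  chart_inv : 'rV[R]_n -> T;
  open_chart_dom : open chart_dom;
  open_chart_img : open chart_img;
  chart_map_img : forall p, chart_dom p -> chart_img (chart_map p);
  chart_inv_dom : forall x, chart_img x -> chart_dom (chart_inv x);
  chart_mapK : forall p, chart_dom p -> chart_inv (chart_map p) = p;
  chart_invK : forall x, chart_img x -> chart_map (chart_inv x) = x;
  chart_map_continuous :
    forall p, chart_dom p -> {for p, continuous chart_map};
  chart_inv_continuous :
    forall x, chart_img x -> {for x, continuous chart_inv} }.

Definition overlap (R : realType) (n : nat) (T : topologicalType)
    (c d : chart R n T) : set 'rV[R]_n :=
  chart_img c `&` (chart_inv c @^-1` chart_dom d).

Definition transition (R : realType) (n : nat) (T : topologicalType)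
    (c d : chart R n T) : 'rV[R]_n -> 'rV[R]_n := chart_map d \o chart_inv c.

Definition compatible (R : realType) (n : nat) (T : topologicalType)
    (c d : chart R n T) : Prop :=
  smooth_map_on (overlap c d) (transition c d) /\
  smooth_map_on (overlap d c) (transition d c).

Record manifold (R : realType) (n : nat) := Manifold {
  mspace :> topologicalType;
  manifold_hausdorff : hausdorff_space mspace;
  manifold_second_countable : @second_countable mspace;
  atlas : set (chart R n mspace);
  atlas_cover : forall p, exists2 c, atlas c & chart_dom c p;
  atlas_compatible : forall c d, atlas c -> atlas d -> compatible c d }.

(* An orientation is a covering of M by charts of the smooth structure whose
   transition maps have positive Jacobian determinant. *)
Definition orientation (R : realType) (n : nat) (M : manifold R n)
    (o : set (chart R n M)) : Prop :=
  [/\ forall c d, o c -> atlas d -> compatible c d,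
      forall p, exists2 c, o c & chart_dom c p
    & forall c d x, o c -> o d -> overlap c d x ->
        0 < \det ('J (transition c d) x)].

Section SmoothFunctions.
Variables (R : realType) (n : nat) (M : manifold R n).

Definition smooth_fun : {pred (M -> R)} := [pred f : M -> R |
  `[< forall c, @atlas R n M c -> smooth_on (chart_img c) (f \o chart_inv c) >]].

Lemma smooth_fun_subring : subring_closed smooth_fun.
Proof.
split=> [|f g /asboolP sf /asboolP sg|f g /asboolP sf /asboolP sg];
  apply/asboolP => c Ac k; have oc := @open_chart_img _ _ _ c.
- exact: (Ck_cst k (1 : R) oc).
- exact: (CkD oc (sf c Ac k) (CkN oc (sg c Ac k))).
- exact: (CkM oc (sf c Ac k) (sg c Ac k)).
Qed.

HB.instance Definition _ :=
  GRing.isSubringClosed.Build (M -> R) smooth_fun smooth_fun_subring.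

Record Cinf := MkCinf {
  Cinf_fun :> M -> R ;
  Cinf_smooth : Cinf_fun \in smooth_fun }.

HB.instance Definition _ := [isSub for Cinf_fun].
HB.instance Definition _ := [Choice of Cinf by <:].
HB.instance Definition _ :=
  GRing.SubChoice_isSubComPzRing.Build _ _ Cinf smooth_fun_subring.

End SmoothFunctions.

Section Geometry.
Variables (R : realType) (n : nat) (M : manifold R n).

(* Tangent vectors at a point act on smooth functions by differentiation;
   vector fields are operators on the ring of smooth functions. *)
Local Notation functional := (Cinf M -> R).
Local Notation operator := (Cinf M -> Cinf M).

Definition at_point (X : operator) (p : M) : functional := fun f => X f p.

Definition tangent (p : M) : set functional :=
  [set v | exists c, exists u, [/\ atlas c, chart_dom c p &
     v = fun f : Cinf M => 'D_u (f \o chart_inv c) (chart_map c p)]].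

(* In each chart X is a combination of the coordinate derivations whose
   coefficients, the components of u, are smooth. *)
Definition vector_field (X : operator) : Prop :=
  forall c, atlas c -> exists2 u : 'rV[R]_n -> 'rV[R]_n,
    smooth_map_on (chart_img c) u &
    forall (f : Cinf M) x, chart_img c x ->
      X f (chart_inv c x) = 'D_(u x) (f \o chart_inv c) x.

Definition bracket (X Y : operator) : operator := (X \o Y) \- (Y \o X).

Definition lcomb k (a : 'I_k -> R) (w : 'I_k -> functional) : functional :=
  fun f => \sum_(i < k) a i * w i f.

Definition lin_indep k (w : 'I_k -> functional) : Prop :=
  forall a : 'I_k -> R, lcomb a w = \0 -> forall i, a i = 0.

Definition span (S : set functional) : set functional :=
  [set v | exists k (a : 'I_k -> R) w, (forall i, S (w i)) /\ v = lcomb a w].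

(* A distribution of tangent subspaces is a smooth subbundle of rank k when it
   has smooth frames near every point; the frame fields may be taken globally
   defined thanks to bump functions. *)
Definition subbundle k (D : M -> set functional) : Prop :=
  forall p : M, exists E : 'I_k -> operator, (forall i, vector_field (E i)) /\
    \forall q \near p, lin_indep (fun i => at_point (E i) q) /\
      D q = span (range (fun i => at_point (E i) q)).

Definition section (D : M -> set functional) (X : operator) : Prop :=
  vector_field X /\ forall p, D p (at_point X p).

Inductive iterated_bracket (D : M -> set functional) : operator -> Prop :=
| ib_section X : section D X -> iterated_bracket D X
| ib_bracket X Y : iterated_bracket D X -> iterated_bracket D Y ->
    iterated_bracket D (bracket X Y).

Definition bracket_generating (D : M -> set functional) : Prop :=
  forall p, tangent p `<=`
    span [set v | exists2 X, iterated_bracket D X & v = at_point X p].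

Definition direct_sum (D E : M -> set functional) : Prop :=
  forall p,
    (forall v, tangent p v -> exists2 h, D p h & E p (v \- h)) /\
    D p `&` E p = [set \0].

Definition inner_product (S : set functional)
    (b : functional -> functional -> R) : Prop :=
  [/\ forall u v, S u -> S v -> b u v = b v u,
      forall (a : R) u v w, S u -> S v -> S w ->
        b (a \*o u \+ v) w = a * b u w + b v w
    & forall u, S u -> u <> \0 -> 0 < b u u].

Definition smooth_inner_product (D : M -> set functional)
    (b : M -> functional -> functional -> R) : Prop :=
  (forall p, inner_product (D p) (b p)) /\
  (forall X Y, section D X -> section D Y ->
     (fun p => b p (at_point X p) (at_point Y p)) \in @smooth_fun R n M).

(* The smooth function b(X, Y); insubd only serves to package the pointwise
   function, which is smooth whenever b is a smooth inner product on a bundle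
   containing X and Y. *)
Definition pairing (b : M -> functional -> functional -> R) (X Y : operator)
    : Cinf M :=
  insubd 0 (fun p => b p (at_point X p) (at_point Y p)).

Definition sRC_manifold k m (H V : M -> set functional)
    (ip : M -> functional -> functional -> R) : Prop :=
  [/\ subbundle k H, bracket_generating H, smooth_inner_product H ip,
      subbundle m V & direct_sum H V].

Definition riemannian_extension (H V : M -> set functional)
    (ip g : M -> functional -> functional -> R) : Prop :=
  [/\ smooth_inner_product tangent g,
      forall p u v, H p u -> H p v -> g p u v = ip p u v
    & forall p u v, H p u -> V p v -> g p u v = 0].

Definition connection (nabla : operator -> operator -> operator) : Prop :=
  [/\ forall A B, vector_field A -> vector_field B -> vector_field (nabla A B),
      forall (f : Cinf M) A A' B,
        vector_field A -> vector_field A' -> vector_field B ->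
        nabla (f \*o A \+ A') B = f \*o nabla A B \+ nabla A' B,
      forall A B B', vector_field A -> vector_field B -> vector_field B' ->
        nabla A (B \+ B') = nabla A B \+ nabla A B'
    & forall (f : Cinf M) A B, vector_field A -> vector_field B ->
        nabla A (f \*o B) = A f \*o B \+ f \*o nabla A B].

Definition torsion (nabla : operator -> operator -> operator) (A B : operator)
    : operator := (nabla A B \- nabla B A) \- bracket A B.

Definition curvature (nabla : operator -> operator -> operator)
    (A B C : operator) : operator :=
  (nabla A (nabla B C) \- nabla B (nabla A C)) \- nabla (bracket A B) C.

Definition metric_compatible (g : M -> functional -> functional -> R)
    (nabla : operator -> operator -> operator) : Prop :=
  forall A B C, vector_field A -> vector_field B -> vector_field C ->
    A (pairing g B C) = pairing g (nabla A B) C + pairing g B (nabla A C).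

Definition parallel (D : M -> set functional)
    (nabla : operator -> operator -> operator) : Prop :=
  forall A B, vector_field A -> section D B -> section D (nabla A B).

(* Tor(D, E) is contained in F *)
Definition torsion_in (nabla : operator -> operator -> operator)
    (D E F : M -> set functional) : Prop :=
  forall A B, section D A -> section E B -> section F (torsion nabla A B).

Definition torsion_symmetric (g : M -> functional -> functional -> R)
    (nabla : operator -> operator -> operator) (E D : M -> set functional)
    : Prop :=
  forall Z X Y, section E Z -> section D X -> section D Y ->
    pairing g (torsion nabla Z X) Y = pairing g (torsion nabla Z Y) X.

Record canonical_connection (H V : M -> set functional)
    (g : M -> functional -> functional -> R)
    (nabla : operator -> operator -> operator) : Prop := CanonicalConnection {
  canonical_is_connection : connection nabla;
  canonical_metric : metric_compatible g nabla;
  canonical_parallelH : parallel H nabla;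
  canonical_parallelV : parallel V nabla;
  canonical_torHH : torsion_in nabla H H V;
  canonical_torVV : torsion_in nabla V V H;
  canonical_symVH : torsion_symmetric g nabla V H;
  canonical_symHV : torsion_symmetric g nabla H V }.

Definition H_normal (H V : M -> set functional)
    (nabla : operator -> operator -> operator) : Prop :=
  torsion_in nabla H V V.

(* A distribution of rank m is integrable when through every point p passes an
   integral manifold, here given by a local parametrization: an injective
   immersion iota of an open subset of R^m. *)
Definition integrable_distribution m (D : M -> set functional) : Prop :=
  forall p, exists (W : set 'rV[R]_m) (iota : 'rV[R]_m -> M),
    [/\ open W,
        exists2 w, W w & iota w = p,
        (forall w, W w -> {for w, continuous iota}) /\
        (forall f : Cinf M, smooth_on W (f \o iota)),
        (forall w w', W w -> W w' -> iota w = iota w' -> w = w') /\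
        (forall w a, W w ->
          (forall f : Cinf M, 'D_a (f \o iota) w = 0) -> a = 0)
      & forall w, W w ->
          D (iota w) = range (fun a (f : Cinf M) => 'D_a (f \o iota) w)].

Definition horizontal_curvature_positive (H : M -> set functional)
    (ip : M -> functional -> functional -> R)
    (nabla : operator -> operator -> operator) : Prop :=
  forall q X Y, section H X -> section H Y ->
    lin_indep (tnth [tuple at_point X q; at_point Y q]) ->
    0 < ip q (at_point (curvature nabla X Y Y) q) (at_point X q).

Definition H_killing (H V : M -> set functional)
    (ip : M -> functional -> functional -> R) (K : operator) : Prop :=
  [/\ vector_field K,
      forall X, section H X -> section H (bracket K X),
      forall X, section V X -> section V (bracket K X)
    & forall X Y, section H X -> section H Y ->
        K (pairing ip X Y) =
          pairing ip (bracket K X) Y + pairing ip X (bracket K Y)].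

(* The D-component of v in the decomposition D p + E p. *)
Definition bundle_proj (D E : M -> set functional) (p : M) (v : functional)
    : functional := get [set h | D p h /\ E p (v \- h)].

End Geometry.

(* Main.v *)
Require Import Defs.
From HB Require Import structures.
From mathcomp Require Import all_boot all_order all_algebra.
From mathcomp Require Import all_classical all_reals all_analysis.
From mathcomp Require Import perm ring lra.
Set Implicit Arguments. Unset Strict Implicit. Unset Printing Implicit Defensive.
Import Order.TTheory GRing.Theory Num.Theory.
Import numFieldNormedType.Exports.
Local Open Scope classical_set_scope.
Local Open Scope ring_scope.

(** Let [W] be the horizontal part of [K] and suppose that it vanishes nowhere.
Three facts are pointwise consequences of the structure equations.
- If [T] is vertical then [nabla T W = 0] ([nabla_vertical]): this vector is
  horizontal, and it is the difference of [nabla W T], the bracket of [W] and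
  [T], and the torsion, which are vertical because [K] preserves [V], [V] is
  integrable, and [M] is [H]-normal.
- If [X] is horizontal then the bracket of [K] and [X] is
  [nabla K X - nabla X W] ([bracket_killing]).
- Hence, by the Killing equation and the compatibility of [nabla] with the
  metric, [X |-> nabla X W] is skew-symmetric on [H] ([nabla_skew]).

The squared length of [W] has a minimum at some point [p], since [M] is
compact. By skew-symmetry its derivative along [X] is [- 2 <nabla W W, X>], so
[nabla W W] vanishes at [p]. As [H] has even rank, the skew-symmetric map
[X |-> nabla X W] on [H] at [p], which kills [W], also kills a horizontal vector
[X] independent of [W] ([kernel_direction]). In this direction the second
derivative of the squared length is [- 2 <R(X, W) W, X>]: all the other terms
contain a factor [nabla X W], [nabla W W] or [nabla T W] with [T] vertical. A
minimum makes it nonnegative ([min_curvature]), while positive curvature makes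
it negative.

This computation is done with globally defined fields, which rests on
differential calculus in coordinates: functions with continuous partial
derivatives are differentiable, second derivatives commute, and smooth bump
functions exist. Bump functions turn local frames into global sections
([frame_sections]) and show that the horizontal part of a vector field, found
by inverting a Gram matrix, is again a vector field ([bundle_proj_local]). The
symmetry of second derivatives makes the sections of an integrable distribution
stable under brackets ([integrable_bracket]). *)

(** * Mean values along lines and the symmetry of second derivatives *)

Section LineDerivative.
Context {R : realType} {n : nat}.
Implicit Types (U : set 'rV[R]_n) (f g : 'rV[R]_n -> R) (x y u v : 'rV[R]_n).

Lemma is_derive_line f y v (t : R) : derivable f (y + t *: v) v ->
  is_derive t 1 (fun t => f (y + t *: v)) ('D_v f (y + t *: v)).
Proof.
have E : (fun h : R => h^-1 *: (((fun t => f (y + t *: v)) \o shift t) (h *: 1)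
            - f (y + t *: v))) =
   (fun h => h^-1 *: ((f \o shift (y + t *: v)) (h *: v) - f (y + t *: v))).
  apply/funext => h /=; congr (_ *: (f _ - _)).
  by rewrite [h%:A]mulr1 scalerDl addrCA.
by move=> df; split; rewrite ?/derivable ?/derive E.
Qed.

Lemma mvt_line f y v (s : R) :
  (forall t : R, `|t| <= `|s| -> derivable f (y + t *: v) v) ->
  exists2 t, `|t| <= `|s| & f (y + s *: v) - f y = s * 'D_v f (y + t *: v).
Proof.
move=> df; pose h (t : R) := f (y + t *: v).
have dh (t : R) : `|t| <= `|s| -> is_derive t 1 h ('D_v f (y + t *: v)).
  by move=> ts; apply: is_derive_line; exact: df.
have h0 : h 0 = f y by rewrite /h scale0r addr0.
have ch t : `|t| <= `|s| -> {for t, continuous h}.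
  by move=> ts; apply/differentiable_continuous/derivable1_diffP; case: (dh t ts).
have seg a b : (forall t, a <= t <= b -> `|t| <= `|s|) ->
    {within `[a, b], continuous h} /\
    forall t, t \in `]a, b[%R -> is_derive t 1 h ('D_v f (y + t *: v)).
  move=> abs; split.
    apply: continuous_in_subspaceT => t; rewrite inE/= in_itv/= => tab.
    exact/ch/abs.
  move=> t; rewrite in_itv/= => /andP[at_ tb]; apply/dh/abs.
  by rewrite !ltW.
have [s0|s0] := leP 0 s.
  have [|cs ds] := seg 0 s.
    by move=> t /andP[t0 ts]; rewrite !ger0_norm.
  have [c + e] := MVT_segment s0 ds cs; rewrite in_itv/= => /andP[c0 cs'].
  exists c; first by rewrite !ger0_norm.
  by rewrite -h0 e subr0 mulrC.
have [|cs ds] := seg s 0.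
  by move=> t /andP[t0 ts]; rewrite !ler0_norm ?(ltW s0)// lerN2.
have [c + e] := MVT_segment (ltW s0) ds cs; rewrite in_itv/= => /andP[c0 cs'].
exists c; first by rewrite !ler0_norm ?lerN2// ltW.
rewrite -h0; apply: oppr_inj; rewrite opprB e; ring.
Qed.

(** The mean value theorem in the direction [u], applied to the increment of [f]
in the direction [v], and then the mean value theorem in the direction [v] turn
the second difference into a value near [x] of an iterated derivative. *)
Lemma second_difference U f x u v (e : R) : 0 < e -> open U -> U x ->
    Ck 2 U f ->
  exists2 d : R, 0 < d & forall s, 0 < s < d ->
  `|f (x + s *: u + s *: v) - f (x + s *: u) - (f (x + s *: v) - f x)
     - s ^+ 2 * 'D_v (fun y => 'D_u f y) x| <= s ^+ 2 * e.
Proof.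
move=> e0 oU Ux [_ [df Df]].
have [_ [ddf DDf]] := Df u; have [cddf _] := DDf v.
have /cvgrPdist_le /(_ e e0) := cddf x Ux.
have /filterI UI : nbhs x U by apply: open_nbhs_nbhs.
move=> /UI /nbhs_ballP [r /= r0 rU].
pose K := `|u| + `|v| + 1.
have K0 : 0 < K by rewrite /K ltr_wpDl.
exists (r / K); first by rewrite divr_gt0.
move=> s /andP[s0 sd].
have sK : s * K < r by rewrite -ltr_pdivlMr.
have inb a b : `|a| <= `|s| -> `|b| <= `|s| -> ball x r (x + a *: u + b *: v).
  rewrite (gtr0_norm s0) => a1 b1; rewrite -ball_normE/=.
  rewrite -addrA opprD addrA subrr sub0r normrN.
  apply: le_lt_trans sK; apply: (le_trans (ler_normD _ _)); rewrite !normrZ.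
  rewrite /K !mulrDr mulr1; apply: ler_wpDr; first exact: ltW.
  by apply: lerD; exact: ler_wpM2r.
pose h y := f (y + s *: v) - f y.
have dh t : `|t| <= `|s| -> is_derive (x + t *: u) u h
     ('D_u f (x + t *: u + s *: v) - 'D_u f (x + t *: u)).
  move=> ts.
  have d1 : derivable f (x + t *: u + s *: v) u.
    by apply: df; have [] := rU _ (inb t s ts (lexx _)).
  have d2 : derivable f (x + t *: u) u.
    by apply: df; have := inb t 0 ts; rewrite normr0 normr_ge0 scale0r addr0 => /(_ isT)/rU[].
  apply: is_deriveB; last exact/derivableP.
  have E : (fun h0 : R => h0^-1 *: (((fun y => f (y + s *: v)) \o shift (x + t *: u)) (h0 *: u)
            - f (x + t *: u + s *: v))) =
   (fun h0 => h0^-1 *: ((f \o shift (x + t *: u + s *: v)) (h0 *: u) - f (x + t *: u + s *: v))).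
    by apply/funext => h0 /=; rewrite !addrA.
  by split; rewrite /derivable /derive E; [exact: d1|].
have [t ts ->] : exists2 t, `|t| <= `|s| &
    f (x + s *: u + s *: v) - f (x + s *: u) - (f (x + s *: v) - f x) =
    s * ('D_u f (x + t *: u + s *: v) - 'D_u f (x + t *: u)).
  have [t ts e1] := @mvt_line h x u s (fun t ts => @ex_derive _ _ _ _ _ _ _ (dh t ts)).
  by exists t => //; rewrite -/(h _) -/(h _) e1; have [_ ->] := dh t ts.
have [|w ws ->] := @mvt_line (fun y => 'D_u f y) (x + t *: u) v s.
  by move=> w ws; apply: ddf; have [] := rU _ (inb t w ts ws).
have [_ /=] := rU _ (inb t w ts ws).
rewrite distrC => le; rewrite mulrA -expr2 -mulrBr normrM ger0_norm ?sqr_ge0//.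
by rewrite ler_pM2l// exprn_gt0.
Qed.

(** Exchanging [u] and [v] does not change the second difference, so both iterated
derivatives are limits of the same quotient. *)
Lemma derive_commute U f x u v : open U -> U x -> Ck 2 U f ->
  'D_v (fun y => 'D_u f y) x = 'D_u (fun y => 'D_v f y) x.
Proof.
move=> oU Ux cf; apply/eqP; rewrite -subr_eq0 -normr_le0; apply/ler_addgt0Pr => e e0; rewrite add0r.
have e2 : 0 < e / 2 by rewrite divr_gt0.
have [d d0 H1] := second_difference u v e2 oU Ux cf.
have [d' d'0 H2] := second_difference v u e2 oU Ux cf.
pose s := Num.min d d' / 2.
have m0 : 0 < Num.min d d' by rewrite lt_min d0.
have s0 : 0 < s by rewrite divr_gt0.
have sm : s < Num.min d d' by rewrite /s ltr_pdivrMr// ltr_pMr// ltr1n.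
have {}H1 := H1 s; have {}H2 := H2 s.
rewrite s0 (lt_le_trans sm) ?ge_min ?lexx//= in H1.
rewrite s0 (lt_le_trans sm) ?ge_min ?lexx ?orbT//= in H2.
have {}H1 := H1 isT; have {}H2 := H2 isT.
have -> : 'D_v (fun y => 'D_u f y) x - 'D_u (fun y => 'D_v f y) x =
  (s ^+ 2)^-1 * (s ^+ 2 * 'D_v (fun y => 'D_u f y) x - s ^+ 2 * 'D_u (fun y => 'D_v f y) x).
  by rewrite -mulrBr mulKf// expf_neq0// gt_eqF.
rewrite normrM gtr0_norm ?invr_gt0 ?exprn_gt0// mulrC ler_pdivrMr ?exprn_gt0//.
have tri (P Q a b c : R) : P = Q -> `|P - a| <= c -> `|Q - b| <= c ->
    `|a - b| <= c + c.
  move=> -> Pa Qb; have -> : a - b = (Q - b) - (Q - a) by ring.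
  by apply: (le_trans (ler_normB _ _)); exact: lerD.
apply: le_trans (tri _ _ _ _ _ _ H1 H2) _.
  have swap (A B C D : R) : A - B - (C - D) = A - C - (B - D) by ring.
  by rewrite [x + s *: u + _]addrAC; exact: swap.
by rewrite -mulrDr -splitr mulrC.
Qed.

End LineDerivative.

(** * Continuous partial derivatives imply differentiability *)

Section Differentiability.
Context {R : realType} {n : nat}.
Implicit Types (U : set 'rV[R]_n) (f g : 'rV[R]_n -> R) (x y u v : 'rV[R]_n).

Local Notation "''e_' j" := (delta_mx 0 j : 'rV[R]_n) (at level 8, j at level 2).

Definition gradient_form (d : 'I_n -> R) v : R := \sum_(j < n) v 0 j * d j.

Lemma gradient_form_linear d : linear (gradient_form d).
Proof.
move=> a u v; rewrite /gradient_form scaler_sumr -big_split/=.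
by apply: eq_bigr => j _; rewrite !mxE mulrDl -mulrA.
Qed.

HB.instance Definition _ d :=
  GRing.isLinear.Build _ _ _ _ (gradient_form d) (gradient_form_linear d).

Lemma gradient_form_continuous d : continuous (gradient_form d).
Proof.
rewrite /gradient_form => x; elim: (index_enum _) => [|j r IH].
  have -> : (fun v => \sum_(j <- [::]) v 0 j * d j) = cst 0 by
    apply/funext => v; rewrite big_nil.
  exact: (@cst_continuous _ R (0:R)).
have -> : (fun v => \sum_(j <- j :: r) v 0 j * d j) =
    (fun v => v 0 j * d j) \+ (fun v => \sum_(j <- r) v 0 j * d j).
  by apply/funext => v; rewrite big_cons.
apply: cvgD IH.
by apply: cvgM; [exact: coord_continuous | exact: cvg_cst].
Qed.

Lemma coord_le_norm v j : `|v 0 j| <= `|v|.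
Proof.
rewrite [leRHS]/Num.Def.normr/= mx_normrE.
exact: (le_bigmax _ (fun i => `|v i.1 i.2|) (0, j)).
Qed.

Lemma norm_le_coord v (e : R) : 0 <= e -> (forall j, `|v 0 j| <= e) -> `|v| <= e.
Proof.
move=> e0 ve; rewrite [leLHS]/Num.Def.normr/= mx_normrE.
by apply/bigmax_le => // -[i j] _ /=; rewrite ord1.
Qed.

(** Passing from [x] to [x + h] one coordinate at a time, each step is controlled
by the mean value theorem and the continuity of one partial derivative. *)
Lemma C1_expansion U f x (e : R) : open U -> U x -> Ck 1 U f -> 0 < e ->
  \forall h \near (0 : 'rV[R]_n),
    `|f (x + h) - f x - gradient_form (fun j => 'D_('e_j) f x) h| <= e * `|h|.
Proof.
move=> oU Ux [_ [df Df]] e0.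
have e1 : 0 < e / n.+1%:R by rewrite divr_gt0.
have : \forall y \near x, U y /\
    forall j, `|'D_('e_j) f x - 'D_('e_j) f y| <= e / n.+1%:R.
  apply: filterI; first exact: open_nbhs_nbhs.
  apply: (@filter_forall _ _ (fun j y => `|'D_('e_j) f x - 'D_('e_j) f y| <=
    e / n.+1%:R) (nbhs x) _) => j.
  have [cD _] := Df ('e_j).
  by have /cvgrPdist_le /(_ _ e1) := cD x Ux.
move=> /nbhs_ballP [r /= r0 rU].
apply/nbhs_ballP; exists r => //= h; rewrite -ball_normE/= sub0r normrN => hr.
pose p k : 'rV[R]_n := \row_j (if (j < k)%N then h 0 j else 0).
have pS (j : 'I_n) : p j.+1 = p j + h 0 j *: 'e_j.
  apply/rowP => i; rewrite !mxE eqxx ltnS leq_eqVlt.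
  case: (eqVneq i j) => [->|ij]; first by rewrite eqxx ltnn add0r mulr1.
  by rewrite -val_eqE/= in ij; rewrite (negPf ij) mulr0 addr0.
have step (j : 'I_n) : `|f (x + p j.+1) - f (x + p j) - h 0 j * 'D_('e_j) f x| <=
    e / n.+1%:R * `|h|.
  have inb (t : R) : `|t| <= `|h 0 j| -> ball x r (x + p j + t *: 'e_j).
    move=> th; rewrite -ball_normE/= -addrA opprD addrA subrr sub0r normrN.
    apply: le_lt_trans hr; apply: norm_le_coord => // i; rewrite !mxE eqxx/=.
    case: (eqVneq i j) => [->|ij].
      by rewrite ltnn add0r mulr1 (le_trans th)// coord_le_norm.
    rewrite mulr0 addr0; case: ifP => _; last by rewrite normr0.
    exact: coord_le_norm.
  have [t th E] := @mvt_line _ _ f (x + p j) ('e_j) (h 0 j)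
    (fun t th => df _ _ (rU _ (inb t th)).1).
  rewrite pS addrA E -mulrBr normrM mulrC.
  apply: ler_pM => //; last exact: coord_le_norm.
  by rewrite distrC; apply: (rU _ (inb t th)).2.
have -> : f (x + h) - f x = \sum_(j < n) (f (x + p j.+1) - f (x + p j)).
  have -> : h = p n by apply/rowP => j; rewrite !mxE ltn_ord.
  rewrite -(big_mkord xpredT (fun j => f (x + p j.+1) - f (x + p j))).
  rewrite telescope_sumr//; congr (_ - f _).
  by rewrite -[LHS]addr0; congr (_ + _); apply/rowP => j; rewrite !mxE.
rewrite /gradient_form -sumrB; apply: (le_trans (ler_norm_sum _ _ _)).
apply: (le_trans (ler_sum _ (fun j _ => step j))).
rewrite sumr_const card_ord -[leLHS]mulr_natl mulrA; apply: ler_wpM2r => //.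
rewrite mulrCA ler_piMr ?(ltW e0)// ler_pdivrMr// mul1r ler_nat.
exact: leqnSn.
Qed.

Lemma C1_differentiable U f x : open U -> U x -> Ck 1 U f -> differentiable f x.
Proof.
move=> oU Ux cf; apply/diffP => /=.
apply: (@getPex _ (fun (df : {linear 'rV[R]_n -> R}) => continuous df /\
  forall y, f y = f (lim (nbhs x)) + df (y - lim (nbhs x))
                  +o_(y \near x) (y - lim (nbhs x)))).
pose L : {linear 'rV[R]_n -> R} := gradient_form (fun j => 'D_('e_j) f x).
exists L; split; first exact: gradient_form_continuous.
have E : f = (fun y => f x + L (y - x)) +o_ x (center x).
  apply/eqaddoP => e e0; near=> y; rewrite /=.
  rewrite -[X in X <= _]/(`|f y - (f x + L (y - x))|) opprD addrA.
  have -> : f y = f (x + (y - x)) by rewrite addrC subrK.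
  near: y; apply/nbhs_ballP.
  have /nbhs_ballP[r /= r0 rU] := C1_expansion oU Ux cf e0.
  exists r => //= y; rewrite -ball_normE/= distrC => yr.
  by apply: rU; rewrite -ball_normE/= sub0r normrN.
apply: eqaddoEx => y; rewrite lim_id// {1}E; reflexivity.
Unshelve. all: by end_near. Qed.

End Differentiability.

(** * Chain rule and differentiability classes *)

Section ChainRule.
Context {R : realType}.

(** On the line through [x] directed by [v] the map [phi] is a curve, and for
functions of one variable derivability is the same as differentiability; so only
[f] has to be differentiable. *)
Lemma is_derive_comp_differentiable (U V W : normedModType R)
    (phi : U -> V) (f : V -> W) x v :
  derivable phi x v -> differentiable f (phi x) ->
  is_derive x v (f \o phi) ('D_('D_v phi x) f (phi x)).
Proof.
move=> dphi df; pose c (h : R) := phi (h *: v + x).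
have c0 : c 0 = phi x by rewrite /c scale0r add0r.
have dc : differentiable c 0 by apply/derivable1_diffP; exact: (derivable1P _ _ _).1 dphi.
have D1 (Z : normedModType R) (F : U -> Z) :
    'D_v F x = 'D_1 (fun h : R => F (h *: v + x)) 0.
  rewrite /derive; set g1 := fun h => h^-1 *: _; set g2 := fun h => h^-1 *: _.
  suff -> : g1 = g2 by [].
  by rewrite funeqE /g1 /g2 => h /=; rewrite addr0 scale0r add0r [_%:A]mulr1.
have df' : differentiable f (c 0) by rewrite c0.
have dfc : differentiable (f \o c) 0 by exact: differentiable_comp.
split; first by apply: (derivable1P _ _ _).2; exact/derivable1_diffP.
have E : 'D_v (f \o phi) x = 'D_1 (f \o c) 0 by rewrite D1.
rewrite E (deriveE _ dfc) diff_comp//= c0.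
by rewrite (deriveE _ df) (D1 _ phi) -/c (deriveE _ dc).
Qed.

Context {n : nat}.
Implicit Types (U : set 'rV[R]_n) (f g : 'rV[R]_n -> R) (x y u v : 'rV[R]_n).

Local Notation "''e_' j" := (delta_mx 0 j : 'rV[R]_n) (at level 8, j at level 2).

Lemma derive_linear U f x (a : R) u v : open U -> U x -> Ck 1 U f ->
  'D_(a *: u + v) f x = a * 'D_u f x + 'D_v f x.
Proof.
move=> oU Ux cf; have df := C1_differentiable oU Ux cf.
by rewrite !(deriveE _ df) linearP.
Qed.

Lemma derive_sum_dir U f x I (r : seq I) (a : I -> R) (w : I -> 'rV[R]_n) :
  open U -> U x -> Ck 1 U f ->
  'D_(\sum_(i <- r) a i *: w i) f x = \sum_(i <- r) a i * 'D_(w i) f x.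
Proof.
move=> oU Ux cf; elim: r => [|i r IH]; first by rewrite !big_nil derive0.
by rewrite !big_cons (derive_linear _ _ _ oU Ux cf) IH.
Qed.

Lemma derive_gradient U f x v : open U -> U x -> Ck 1 U f ->
  'D_v f x = \sum_j v 0 j * 'D_('e_j) f x.
Proof.
by move=> oU Ux cf; rewrite {1}(row_sum_delta v) (derive_sum_dir _ _ _ oU Ux cf).
Qed.

Lemma derivable_row m (phi : 'rV[R]_n -> 'rV[R]_m) x v :
  (forall j, derivable (fun y => phi y 0 j) x v) ->
  derivable phi x v /\ 'D_v phi x = \row_j 'D_v (fun y => phi y 0 j) x.
Proof.
move=> dphi; have d : derivable phi x v.
  by apply/derivable_mxP => i j; rewrite ord1; exact: dphi.
by split=> //; rewrite derive_mx//; apply/rowP => j; rewrite !mxE.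
Qed.

Lemma continuous_row m (phi : 'rV[R]_n -> 'rV[R]_m) x :
  (forall j, {for x, continuous (fun y => phi y 0 j)}) ->
  {for x, continuous phi}.
Proof.
move=> cphi; apply: (@cvgrPdist_le R 'rV[R]_m 'rV[R]_n (nbhs x) _ phi (phi x)).2.
move=> e e0; near=> y.
apply: norm_le_coord; first exact: ltW.
move=> j; rewrite !mxE; move: j; near: y.
apply: (@filter_forall _ _ (fun j y => `|phi x 0 j - phi y 0 j| <= e)
  (nbhs x) _) => j.
by have /cvgrPdist_le /(_ _ e0) := cphi j.
Unshelve. all: by end_near. Qed.

End ChainRule.

Section CkMore.
Context {R : realType} {n : nat}.
Implicit Types (U : set 'rV[R]_n) (f g : 'rV[R]_n -> R) (x y u v : 'rV[R]_n).

Lemma Ck_sub k U V f : V `<=` U -> Ck k U f -> Ck k V f.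
Proof.
move=> VU; elim: k f => [|k IH] f [cf].
  by move=> _; split=> // x /VU; exact: cf.
move=> [df Df]; split; first by move=> x /VU; exact: cf.
by split=> [x v /VU|v]; [exact: df|apply: IH; exact: Df].
Qed.

Lemma Ck_le k l U f : (k <= l)%N -> Ck l U f -> Ck k U f.
Proof. by move=> /subnK <-; elim: (l - k)%N => //= i IH /CkW. Qed.

Lemma Ck_local k U f :
  (forall x, U x -> exists2 V, V x & Ck k V f) -> Ck k U f.
Proof.
elim: k f => [|k IH] f H.
  by split=> // x /H[V Vx [cf _]]; exact: cf.
split; first by move=> x /H[V Vx [cf _]]; exact: cf.
split=> [x v /H[V Vx [_ [df _]]]|v]; first exact: df.
by apply: IH => x /H[V Vx [_ [_ Df]]]; exists V => //; exact: Df.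
Qed.

Lemma Ck_sum k U I (r : seq I) (F : I -> 'rV[R]_n -> R) : open U ->
  (forall i, Ck k U (F i)) -> Ck k U (fun x => \sum_(i <- r) F i x).
Proof.
move=> oU cF; elim: r => [|i r IH].
  by apply: (Ck_ext oU _ (Ck_cst k 0 oU)) => x _; rewrite big_nil.
by apply: (Ck_ext oU _ (CkD oU (cF i) IH)) => x _; rewrite big_cons.
Qed.

Lemma Ck_prod k U I (r : seq I) (F : I -> 'rV[R]_n -> R) : open U ->
  (forall i, Ck k U (F i)) -> Ck k U (fun x => \prod_(i <- r) F i x).
Proof.
move=> oU cF; elim: r => [|i r IH].
  by apply: (Ck_ext oU _ (Ck_cst k 1 oU)) => x _; rewrite big_nil.
by apply: (Ck_ext oU _ (CkM oU (cF i) IH)) => x _; rewrite big_cons.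
Qed.

Lemma is_derive_coord x v (j : 'I_n) : is_derive x v (fun y : 'rV[R]_n => y 0 j) (v 0 j).
Proof.
have d : derivable (@id 'rV[R]_n) x v by exact: derivable_id.
have /derivable_mxP /(_ 0 j) dj := d.
split=> //; have /(congr1 (fun w : 'rV[R]_n => w 0 j)) := derive_mx d.
by rewrite derive_id mxE => <-.
Qed.

Lemma Ck_coord k U (j : 'I_n) : open U -> Ck k U (fun x : 'rV[R]_n => x 0 j).
Proof.
move=> oU; case: k => [|k]; first by split=> // x _; exact: coord_continuous.
split; first by move=> x _; exact: coord_continuous.
split=> [x v _|v]; first by have [] := is_derive_coord x v j.
apply: (Ck_ext oU _ (Ck_cst k (v 0 j) oU)) => x _ /=.
by have [_ ->] := is_derive_coord x v j.
Qed.

End CkMore.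

Section CkComposition.
Context {R : realType} {n : nat}.
Implicit Types (U : set 'rV[R]_n) (f g : 'rV[R]_n -> R) (x y u v : 'rV[R]_n).

(** The derivative of the composite is a sum of products of derivatives of the
coordinates of [phi] with partial derivatives of [f] composed with [phi], to
which the induction hypothesis applies. *)
Lemma Ck_comp k m (U : set 'rV[R]_n) (V : set 'rV[R]_m)
    (phi : 'rV[R]_n -> 'rV[R]_m) (f : 'rV[R]_m -> R) :
  open U -> open V -> (forall x, U x -> V (phi x)) ->
  (forall j, Ck k U (fun x => phi x 0 j)) -> Ck k V f -> Ck k U (f \o phi).
Proof.
move=> oU oV UV; elim: k f => [|k IH] f cphi cf.
  split=> // x Ux; apply: continuous_comp; last by have [+ _] := cf; apply; exact: UV.
  by apply: continuous_row => j; have [+ _] := cphi j; apply.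
have cphi1 j : Ck 1 U (fun x => phi x 0 j) by apply: Ck_le (cphi j).
have cf1 : Ck 1 V f by apply: Ck_le cf.
have D x v : U x -> is_derive x v (f \o phi)
    (\sum_j 'D_v (fun y => phi y 0 j) x * 'D_(delta_mx 0 j) f (phi x)).
  move=> Ux; have [j|dphi Dphi] := @derivable_row _ _ _ phi x v.
    by have [_ [d _]] := cphi1 j; exact: d.
  apply: is_derive_eq.
    apply: is_derive_comp_differentiable => //.
    exact: (C1_differentiable oV (UV _ Ux) cf1).
  rewrite (derive_gradient _ oV (UV _ Ux) cf1) Dphi.
  by apply: eq_bigr => j _; rewrite mxE.
split.
  move=> x Ux; apply: continuous_comp; last by have [+ _] := cf; apply; exact: UV.
  by apply: continuous_row => j; have [+ _] := cphi j; apply.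
split=> [x v Ux|v]; first by have [] := D x v Ux.
apply: (Ck_ext oU (f := fun x => \sum_j 'D_v (fun y => phi y 0 j) x *
    ('D_(delta_mx 0 j) f \o phi) x)).
  by move=> x Ux; have [_ ->] := D x v Ux.
apply: Ck_sum => // j; apply: CkM => //; first by have [_ [_]] := cphi j; apply.
apply: IH; first by move=> i; exact: CkW.
by have [_ [_]] := cf; apply.
Qed.

(** A sequence in which each function is the derivative of the previous one is the
form in which the smoothness of a function of one variable enters the induction. *)
Lemma Ck_comp1 k U (th : nat -> R -> R) f : open U ->
  (forall i (t : R), is_derive t 1 (th i) (th i.+1 t)) ->
  Ck k U f -> forall i, Ck k U (th i \o f).
Proof.
move=> oU dth; have cth i t : {for t, continuous (th i)}.
  by apply/differentiable_continuous/derivable1_diffP; case: (dth i t).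
elim: k => [|k IH] cf i.
  by split=> // x Ux; apply: continuous_comp; [have [+ _] := cf; apply|exact: cth].
have D x v : U x -> is_derive x v (th i \o f) ('D_v f x * th i.+1 (f x)).
  move=> Ux; have [_ [df _]] := cf.
  have dt : differentiable (th i) (f x) by apply/derivable1_diffP; case: (dth i (f x)).
  apply: is_derive_eq; first by apply: is_derive_comp_differentiable => //; exact: df.
  rewrite (deriveE _ dt) -[X in 'd _ _ X]mulr1.
  rewrite -[_ * 1]/(_ *: 1) linearZ/= -(deriveE _ dt).
  by have [_ ->] := dth i (f x).
split; first by move=> x Ux; apply: continuous_comp; [have [+ _] := cf; apply|exact: cth].
split=> [x v Ux|v]; first by have [] := D x v Ux.
apply: (Ck_ext oU (f := 'D_v f \* (th i.+1 \o f))).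
  by move=> x Ux; have [_ ->] := D x v Ux.
by apply: CkM => //; [have [_ [_]] := cf; apply|apply: IH; exact: CkW].
Qed.

Lemma Ck_inv k U f : open U -> (forall x, U x -> f x != 0) -> Ck k U f ->
  Ck k U (fun x => (f x)^-1).
Proof.
move=> oU f0; have cV x : U x -> {for x, continuous f} ->
    {for x, continuous (fun x => (f x)^-1)}.
  by move=> Ux; apply: (@cvgV _ _ (nbhs x) _ f (f x) (f0 x Ux)).
elim: k => [|k IH] cf.
  by split=> // x Ux; apply: cV => //; have [+ _] := cf; apply.
split; first by move=> x Ux; apply: cV => //; have [+ _] := cf; apply.
have [_ [df Df]] := cf.
split=> [x v Ux|v]; first by apply: derivableV; [exact: f0|exact: df].
apply: (Ck_ext oU (f := \- ('D_v f \* ((fun x => (f x)^-1) \* (fun x => (f x)^-1))))).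
  move=> x Ux; rewrite [RHS](deriveV (f0 x Ux) (df x v Ux)) /= scaleNr; congr (- _).
  by rewrite -[LHS]/(_ * _) expr2 mulrC invfM.
have ci := IH (CkW cf).
by apply: CkN => //; exact: (CkM oU (Df v) (CkM oU ci ci)).
Qed.

Lemma derive_at_min U f x v : open U -> U x -> Ck 1 U f ->
  (forall y, U y -> f x <= f y) -> 'D_v f x = 0.
Proof.
move=> oU Ux cf fmin.
have df := C1_differentiable oU Ux cf.
have D := @is_derive_line _ _ f x v 0; rewrite scale0r addr0 in D.
have [dl El] := D (diff_derivable df).
have : nbhs x U by apply: open_nbhs_nbhs.
move=> /nbhs_ballP [r /= r0 rU].
(* Adding 1 keeps the denominator positive when [v] is zero. *)
pose s := r / (`|v| + 1).
have s0 : 0 < s by rewrite divr_gt0// ltr_wpDl.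
have inU t : t \in `]- s, s[%R -> U (x + t *: v).
  rewrite in_itv/= -ltr_norml => ts; apply: rU; rewrite -ball_normE/=.
  rewrite opprD addrA subrr sub0r normrN normrZ.
  apply: (@le_lt_trans _ _ (`|t| * (`|v| + 1))).
    by rewrite ler_wpM2l// lerDl.
  by rewrite -ltr_pdivlMr// ltr_wpDl.
have min0 : is_derive (0 : R) 1 (fun t : R => f (x + t *: v)) 0.
  apply: (@derive1_at_min _ _ (- s) s) => [|t ts||t ts].
  - by rewrite ge0_cp ?ltW.
  - by have [] := is_derive_line
      (diff_derivable (C1_differentiable oU (inU _ ts) cf)).
  - by rewrite in_itv/= oppr_lt0 s0.
  - by rewrite scale0r addr0; apply: fmin; exact: inU.
by rewrite -El; have [] := min0.
Qed.

(** The second difference for the directions [v] and [- v] is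
[2 f(x) - f(x + s v) - f(x - s v)], which is nonpositive at a minimum. *)
Lemma second_derive_at_min U f x v : open U -> U x -> Ck 2 U f ->
  (forall y, U y -> f x <= f y) -> 0 <= 'D_v (fun y => 'D_v f y) x.
Proof.
move=> oU Ux cf fmin; rewrite leNgt; apply/negP => c0.
set c := 'D_v _ _ in c0.
have e0 : 0 < - c / 2 by rewrite divr_gt0// oppr_gt0.
have [d d0 H] := second_difference v (- v) e0 oU Ux cf.
have cD : Ck 1 U (fun y => 'D_v f y) by have [_ [_]] := cf; apply.
have DN : 'D_(- v) (fun y => 'D_v f y) x = - c.
  have := derive_linear (-1) v 0 oU Ux cD.
  by rewrite scaleN1r addr0 derive0 addr0 mulN1r.
have : nbhs x U by apply: open_nbhs_nbhs.
move=> /nbhs_ballP [r /= r0 rU].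
pose s := Num.min d (r / (`|v| + 1)) / 2.
have m0 : 0 < Num.min d (r / (`|v| + 1)).
  by rewrite lt_min d0 divr_gt0// ltr_wpDl.
have s0 : 0 < s by rewrite divr_gt0.
have sm : s < Num.min d (r / (`|v| + 1)) by rewrite /s ltr_pdivrMr// ltr_pMr// ltr1n.
move: sm; rewrite lt_min => /andP[sd sr].
have inU t : `|t| <= s -> U (x + t *: v).
  move=> ts; apply: rU; rewrite -ball_normE/=.
  rewrite opprD addrA subrr sub0r normrN normrZ.
  apply: (@le_lt_trans _ _ (s * (`|v| + 1))).
    by apply: ler_pM => //; rewrite lerDl.
  by rewrite -ltr_pdivlMr// ltr_wpDl.
have fp := fmin _ (inU s _); rewrite gtr0_norm// lexx in fp.
have fm := fmin _ (inU (- s) _); rewrite normrN gtr0_norm// lexx in fm.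
have := H s; rewrite s0 sd => /(_ isT); rewrite ler_norml => /andP[+ _].
rewrite DN scalerN addrK -scalerN => le.
have {}fp := fp isT; have {}fm := fm isT; rewrite scaleNr -scalerN in fm.
have : 0 < s ^+ 2 * - c by rewrite mulr_gt0 ?exprn_gt0 ?oppr_gt0.
move: le; rewrite mulrA; move: fp fm.
move: (s ^+ 2 * - c) (f (x + s *: v)) (f (x + s *: - v)) (f x) => A B C D.
lra.
Qed.

End CkComposition.

(** * Bump functions *)

Section Bump.
Context {R : realType}.

Lemma expr_le_expR (m : nat) (s : R) : 0 <= s -> s ^+ m <= m%:R ^+ m * expR s.
Proof.
move=> s0; case: m => [|m]; first by rewrite !expr0 mul1r -expR0 ler_expR.
have m0 : (0 : R) < m.+1%:R by [].
have -> : expR s = expR (s / m.+1%:R) ^+ m.+1.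
  by rewrite -expRM_natl mulrC divfK// gt_eqF.
rewrite -exprMn; apply: lerXn2r; rewrite ?nnegrE// ?mulr_ge0 ?expR_ge0//.
rewrite mulrC -ler_pdivrMr//; apply: le_trans (expR_ge1Dx _).
by rewrite lerDr.
Qed.

(** For [p = 1] this is [exp(- 1 / t)] extended by zero, whose derivatives all
vanish at the origin; the polynomial factors make the family stable under
derivation. *)
Definition flat (p : {poly R}) (t : R) : R :=
  if 0 < t then p.[t^-1] * expR (- t^-1) else 0.

(** The exponential dominates every power of [1 / t], and a quadratic bound is what
the derivative at the origin requires. *)
Lemma flat_le_square (p : {poly R}) :
  exists2 C : R, 0 <= C & forall t : R, `|flat p t| <= C * t ^+ 2.
Proof.
pose C := \sum_(i < size p) `|p`_i| * (i + 2)%N%:R ^+ (i + 2).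
have C0 : 0 <= C by apply: sumr_ge0 => i _; rewrite mulr_ge0// exprn_ge0.
exists C => // t; rewrite /flat; case: ifPn => [t0|_]; last first.
  by rewrite normr0 mulr_ge0// sqr_ge0.
have s0 : 0 < t^-1 by rewrite invr_gt0.
rewrite normrM (gtr0_norm (expR_gt0 _)) expRN ler_pdivrMr ?expR_gt0//.
rewrite horner_coef; apply: (le_trans (ler_norm_sum _ _ _)).
rewrite /C !mulr_suml; apply: ler_sum => i _.
rewrite normrM normrX (gtr0_norm s0).
have -> : `|p`_i| * (i + 2)%N%:R ^+ (i + 2) * t ^+ 2 * expR t^-1 =
    `|p`_i| * (t ^+ 2 * ((i + 2)%N%:R ^+ (i + 2) * expR t^-1)) by ring.
have -> : t^-1 ^+ i = t ^+ 2 * t^-1 ^+ (i + 2).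
  by rewrite exprD mulrCA -exprMn mulfV ?gt_eqF// expr1n mulr1.
do 2 (apply: ler_wpM2l; first by rewrite ?sqr_ge0).
exact/expr_le_expR/ltW.
Qed.

Definition flat_step (p : {poly R}) : {poly R} := 'X^2 * (p - p^`()).

Lemma is_derive_flat (p : {poly R}) (t : R) :
  is_derive t 1 (flat p) (flat (flat_step p) t).
Proof.
case: (ltgtP t 0) => [t0|t0|->].
- have -> : flat (flat_step p) t = 0 by rewrite /flat ltNge ltW.
  apply: near_eq_is_derive (is_derive_cst _ _ _).
  near=> s; rewrite /flat ltNge ltW//=.
  by near: s; exact: lt_nbhsl.
- have t1 : t != 0 by rewrite gt_eqF.
  apply: (@near_eq_is_derive _ _ _ (fun t : R => p.[t^-1] * expR (- t^-1))).
    near=> s; rewrite /flat; have -> // : 0 < s.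
    by near: s; exact: lt_nbhsr.
  have dV : is_derive t 1 (fun t : R => t^-1) (- t ^- 2).
    by apply: is_derive_eq (@is_deriveV _ id t 1 1 t1 _) _; rewrite [LHS]mulr1.
  have dp := is_derive1_comp (is_derive_poly p t^-1) dV.
  have de := @is_derive1_comp _ expR (fun t : R => - t^-1) t _ _
    (is_derive_expR (- t^-1)) (is_deriveN dV).
  apply: is_derive_eq (is_deriveM dp de) _.
  rewrite /flat t0 /flat_step !hornerE/= opprK -!exprVn /GRing.scale/=; ring.
- have -> : flat (flat_step p) 0 = 0 by rewrite /flat ltxx.
  have [C C0 HC] := flat_le_square p.
  suff H : (fun h : R => h^-1 *: ((flat p \o shift 0) (h *: 1) - flat p 0)) @ 0^' --> (0 : R).
    by split; [apply/cvg_ex; exists 0 | exact: cvg_lim].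
  apply/cvgrPdist_le => e e0.
  near=> h; rewrite /= sub0r normrN {2}/flat ltxx subr0 addr0 [h%:A]mulr1.
  have h0 : h != 0 by near: h; exact: nbhs_dnbhs_neq.
  rewrite normrM normfV ler_pdivrMl ?normr_gt0//.
  apply: (le_trans (HC h)); rewrite -(real_normK (num_real h)) expr2 mulrCA ler_wpM2l//.
  have : `|h| < e / (C + 1).
    by near: h; apply: dnbhs0_lt; rewrite divr_gt0// ltr_wpDl.
  rewrite ltr_pdivlMr ?ltr_wpDl// => /ltW; apply: le_trans.
  by rewrite mulrC ler_wpM2l// lerDl.
Unshelve. all: by end_near. Qed.

Definition flat_poly (i : nat) : {poly R} := iter i flat_step 1.

Lemma Ck_flat n k (U : set 'rV[R]_n) (f : 'rV[R]_n -> R) : open U ->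
  Ck k U f -> Ck k U (flat 1 \o f).
Proof.
move=> oU cf; apply: (@Ck_comp1 _ _ k U (fun i => flat (flat_poly i)) f oU _ cf 0%N).
by move=> i t; exact: is_derive_flat.
Qed.

Lemma flat_gt0 (t : R) : 0 < t -> 0 < flat 1 t.
Proof. by move=> t0; rewrite /flat t0 hornerC mul1r expR_gt0. Qed.

Lemma flat_eq0 (t : R) : t <= 0 -> flat 1 t = 0.
Proof. by move=> t0; rewrite /flat ltNge t0. Qed.

Lemma flat_ge0 (t : R) : 0 <= flat 1 t.
Proof. by case: (ltP 0 t) => [/flat_gt0/ltW|/flat_eq0 ->]. Qed.

Lemma flatD_gt0 (t : R) : 0 < flat 1 t + flat 1 (1 - t).
Proof.
case: (ltP 0 t) => t0; first by rewrite ltr_pwDl// ?flat_gt0 ?flat_ge0.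
by rewrite ltr_wpDl ?flat_ge0// flat_gt0//; lra.
Qed.

Definition smooth_step (t : R) : R := flat 1 t / (flat 1 t + flat 1 (1 - t)).

Lemma smooth_step_ge0 t : 0 <= smooth_step t.
Proof. by rewrite divr_ge0 ?flat_ge0// ltW// flatD_gt0. Qed.

Lemma smooth_step_le1 t : smooth_step t <= 1.
Proof. by rewrite ler_pdivrMr ?flatD_gt0// mul1r lerDl flat_ge0. Qed.

Lemma smooth_step_eq0 t : t <= 0 -> smooth_step t = 0.
Proof. by move=> t0; rewrite /smooth_step flat_eq0 ?mul0r. Qed.

Lemma smooth_step_eq1 t : 1 <= t -> smooth_step t = 1.
Proof.
move=> t1; rewrite /smooth_step (@flat_eq0 (1 - t)) ?addr0 ?subr_le0//.
by rewrite mulfV// gt_eqF// flat_gt0//; lra.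
Qed.

Lemma Ck_smooth_step n k (U : set 'rV[R]_n) (f : 'rV[R]_n -> R) : open U ->
  Ck k U f -> Ck k U (smooth_step \o f).
Proof.
move=> oU cf; apply: CkM => //; first exact: Ck_flat.
apply: Ck_inv => //; first by move=> x _; rewrite gt_eqF// flatD_gt0.
apply: CkD => //; first exact: Ck_flat.
have c1 : Ck k U (fun x => 1 - f x) by exact: CkD (Ck_cst k 1 oU) (CkN oU cf).
exact: (Ck_flat oU c1).
Qed.

(** The norm is the maximum of the absolute values of the coordinates, so a product
over the coordinates of cut-off functions of one variable is 1 on a ball and
vanishes off a larger ball. *)
Lemma bump_exists n (a : 'rV[R]_n) (r : R) : 0 < r ->
  exists psi : 'rV[R]_n -> R,
  [/\ forall k, Ck k setT psi, forall x, 0 <= psi x <= 1,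
      forall x, `|x - a| <= r / 2 -> psi x = 1
    & forall x, r <= `|x - a| -> psi x = 0].
Proof.
move=> r0.
pose l (s : R) (j : 'I_n) (x : 'rV[R]_n) : R := 2 + s * 2 / r * (x 0 j - a 0 j).
(* The first factor vanishes for [x j <= a j - r], the second for [a j + r <= x j],
   and both are 1 for [x j] at distance at most [r / 2] from [a j]. *)
pose q j x := smooth_step (l 1 j x) * smooth_step (l (-1) j x).
have q01 j x : 0 <= q j x <= 1.
  rewrite mulr_ge0 ?smooth_step_ge0//= -[leRHS]mulr1.
  by apply: ler_pM; rewrite ?smooth_step_ge0 ?smooth_step_le1.
have T : open [set: 'rV[R]_n] by exact: openT.
exists (fun x => \prod_j q j x); split.
- move=> k; apply: Ck_prod => // j.
  have cl s : Ck k setT (l s j).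
    apply: (CkD T (Ck_cst k 2 T)); apply: (CkM T (Ck_cst k (s * 2 / r) T)).
    exact: (CkD T (Ck_coord k j T) (Ck_cst k (- a 0 j) T)).
  by apply: CkM => //; exact: Ck_smooth_step.
- move=> x; apply/andP; split.
    by apply: prodr_ge0 => j _; have /andP[] := q01 j x.
  by apply: prodr_ile1 => j _; exact: q01.
- move=> x xa; apply: big1 => j _.
  have : `|x 0 j - a 0 j| <= r / 2.
    by apply: le_trans xa; have := coord_le_norm (x - a) j; rewrite !mxE.
  rewrite ler_norml => /andP[H1 H2].
  have inv0 : 0 < 2 / r by rewrite divr_gt0.
  have e1 : 2 / r * (r / 2) = 1 by field; rewrite gt_eqF.
  have := ler_wpM2l (ltW inv0) H1; have := ler_wpM2l (ltW inv0) H2.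
  rewrite mulrN e1 => h2 h1.
  by rewrite /q !smooth_step_eq1 ?mulr1// /l ?mul1r ?mulN1r ?mulNr; lra.
- move=> x xa.
  have [j xj] : exists j, r <= `|x 0 j - a 0 j|.
    apply: contrapT => /forallNP H; move: xa; apply/negP; rewrite -ltNge.
    rewrite [ltLHS]/Num.Def.normr/= mx_normrE; apply/bigmax_lt => // -[i j] _ /=.
    by rewrite ord1 !mxE ltNge; apply/negP; exact: H.
  rewrite (bigD1 j)//=; suff -> : q j x = 0 by rewrite mul0r.
  have inv0 : 0 < 2 / r by rewrite divr_gt0.
  have e1 : 2 / r * r = 2 by field; rewrite gt_eqF.
  move: xj; rewrite ler_normr => /orP[] /(ler_wpM2l (ltW inv0)); rewrite e1 => h.
    rewrite /q [X in _ * X]smooth_step_eq0 ?mulr0// /l ?mul1r ?mulN1r ?mulNr; lra.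
  rewrite /q smooth_step_eq0 ?mul0r// /l ?mul1r ?mulN1r ?mulNr; lra.
Qed.

End Bump.

(** * Smooth functions on a manifold *)

Section SmoothFunctions.
Context {R : realType} {n : nat} {M : manifold R n}.
Implicit Types (p q : M) (f g : Cinf M) (c d : chart R n M).

Lemma Cinf_chart f c k : atlas c -> Ck k (chart_img c) (f \o chart_inv c).
Proof. by move=> Ac; have /asboolP := Cinf_smooth f; apply. Qed.

Lemma near_chart_inv c x (P : set M) : chart_img c x -> nbhs (chart_inv c x) P ->
  \forall y \near x, chart_img c y /\ P (chart_inv c y).
Proof.
move=> cx nP; apply: filterI; last exact: (chart_inv_continuous cx nP).
by apply: open_nbhs_nbhs; split => //; exact: open_chart_img.
Qed.

Lemma open_chart_inv c x (P : set M) : chart_img c x ->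
  nbhs (chart_inv c x) P -> exists V : set 'rV[R]_n,
    [/\ open V, V x & forall y, V y -> chart_img c y /\ P (chart_inv c y)].
Proof.
move=> cx nP; exists (interior (fun y => chart_img c y /\ P (chart_inv c y))).
split; first exact: open_interior.
  by have /nbhs_interior/nbhs_singleton := near_chart_inv cx nP.
by move=> y /interior_subset.
Qed.

Lemma near_chart_map c p (P : set 'rV[R]_n) : chart_dom c p ->
  nbhs (chart_map c p) P ->
  \forall q \near p, chart_dom c q /\ P (chart_map c q).
Proof.
move=> cp nP; apply: filterI; last exact: (chart_map_continuous cp nP).
by apply: open_nbhs_nbhs; split => //; exact: open_chart_dom.
Qed.

Lemma near_chart_dom c p : chart_dom c p -> \forall q \near p, chart_dom c q.
Proof.
by move=> cp; apply: open_nbhs_nbhs; split => //; exact: open_chart_dom.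
Qed.

Lemma overlap_open c d : open (overlap c d).
Proof.
rewrite openE => x [cx dx]; apply: (near_chart_inv cx).
by apply: open_nbhs_nbhs; split => //; exact: open_chart_dom.
Qed.

Lemma Cinf_continuous f : continuous (f : M -> R).
Proof.
move=> p; have [c Ac cp] := atlas_cover p.
have [cf _] := @Cinf_chart f c 0 Ac.
have cm := chart_map_img cp.
have H : {for p, continuous ((f \o chart_inv c) \o chart_map c)}.
  apply: (@continuous_comp _ _ _ (chart_map c) (f \o chart_inv c)); first exact: chart_map_continuous.
  exact: cf.
have E : \forall q \near p, ((f \o chart_inv c) \o chart_map c) q = f q.
  have := near_chart_dom cp.
  by apply: filterS => q cq /=; rewrite chart_mapK.
move: H; rewrite /prop_for /continuous_at /= chart_mapK// => H.
by apply: cvg_trans H; apply: (@near_eq_cvg _ _ (nbhs p)); exact: E.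
Qed.

Lemma smooth_fun_local (F : M -> R) :
  (forall p, exists f : Cinf M, \forall q \near p, F q = f q) ->
  F \in @smooth_fun R n M.
Proof.
move=> H; apply/asboolP => c Ac k; apply: Ck_local => x cx.
have [f Ff] := H (chart_inv c x).
have [V [oV Vx sV]] := open_chart_inv cx Ff; exists V => //.
apply: (@Ck_ext _ _ _ _ (f \o chart_inv c)) => //; first by move=> y /sV[_ /= ->].
by apply: Ck_sub (Cinf_chart f k Ac) => y /sV[].
Qed.

(** The support lies in the image of a closed ball, which is compact, hence closed in
the Hausdorff space [M]: this makes the extension by zero smooth off the chart. *)
Lemma smooth_fun_extend c (h : 'rV[R]_n -> R) (a : 'rV[R]_n) (r : R) :
  atlas c -> (forall k, Ck k (chart_img c) h) ->
  [set x | `|x - a| <= r] `<=` chart_img c ->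
  (forall x, r < `|x - a| -> h x = 0) ->
  (fun p => if `[< chart_dom c p >] then h (chart_map c p) else 0)
    \in @smooth_fun R n M.
Proof.
move=> Ac ch rc h0; apply/asboolP => d Ad k.
set F := fun p => _; pose B := [set x : 'rV[R]_n | `|x - a| <= r].
have cB : compact B.
  apply: bounded_closed_compact.
    exists (`|a| + r); split; first exact: num_real.
    move=> M0 M0r x /= xr; apply: ltW; apply: le_lt_trans M0r.
    rewrite -[x](subrK a) addrC; apply: (le_trans (ler_normD _ _)).
    by rewrite lerD2l.
  rewrite (_ : B = closed_ball_ Num.norm a r); first exact: closed_closed_ball_.
  by apply/seteqP; split=> x; rewrite /B /closed_ball_ /= distrC.
have cK : closed (chart_inv c @` B).
  apply: compact_closed; first exact: manifold_hausdorff.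
  apply: continuous_compact cB; apply: continuous_in_subspaceT => x.
  by rewrite inE => /rc cx; exact: chart_inv_continuous.
apply: Ck_local => y dy.
have [cy|ncy] := pselect (chart_dom c (chart_inv d y)).
  exists (overlap d c) => //.
  have [tdc _] := atlas_compatible Ad Ac.
  apply: (@Ck_ext _ _ _ _ (h \o transition d c)); first exact: overlap_open.
    by move=> z [dz cz]; rewrite /F /=; case: asboolP.
  apply: (@Ck_comp _ _ k _ (overlap d c) (chart_img c)) => //.
  - exact: overlap_open.
  - exact: open_chart_img.
  - by move=> z [dz cz]; exact: chart_map_img.
  - by move=> j; exact: tdc.
have nK : ~ (chart_inv c @` B) (chart_inv d y).
  by move=> [x Bx xy]; apply: ncy; rewrite -xy; exact/chart_inv_dom/rc.
have oK : nbhs (chart_inv d y) (~` (chart_inv c @` B)).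
  by apply: open_nbhs_nbhs; split => //; exact: closed_openC.
have [V [oV Vy sV]] := open_chart_inv dy oK; exists V => //.
apply: (Ck_ext oV _ (Ck_cst k 0 oV)) => z /sV[_ /= nz].
rewrite /F; case: asboolP => // cz; rewrite h0// ltNge; apply/negP => zr.
by apply: nz; exists (chart_map c (chart_inv d z)) => //; rewrite chart_mapK.
Qed.

(** The cut-off [b] is kept apart from [h] so that the bounds on [b] are available
when [h] is constant, which gives bump functions on [M]. *)
Lemma Cinf_extend c p (h : 'rV[R]_n -> R) (U : set M) : atlas c ->
  chart_dom c p -> (forall k, Ck k setT h) -> nbhs p U ->
  exists2 f : Cinf M, \forall q \near p, f q = h (chart_map c q) &
    exists2 b : M -> R, (forall q, 0 <= b q <= 1 /\ (~ U q -> b q = 0)) &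
      forall q, f q = b q * h (chart_map c q).
Proof.
move=> Ac cp ch nU; pose a := chart_map c p.
have ca : chart_img c a by exact: chart_map_img.
have := @near_chart_inv c a U ca; rewrite chart_mapK// => /(_ nU).
move=> /nbhs_ballP[r /= r0 rU].
have r2 : 0 < r / 2 by rewrite divr_gt0.
have [psi [cpsi psi01 psi1 psi0]] := bump_exists a r2.
have inr x : `|x - a| <= r / 2 -> ball a r x.
  move=> xa; rewrite -ball_normE/= distrC; apply: le_lt_trans xa _.
  by rewrite ltr_pdivrMr// ltr_pMr// ltr1n.
have sub : [set x | `|x - a| <= r / 2] `<=` chart_img c.
  by move=> x /inr/rU[].
have cph k : Ck k (chart_img c) (psi \* h).
  by apply: (@Ck_sub _ _ _ setT) => //; apply: CkM => //; exact: openT.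
have ph0 x : r / 2 < `|x - a| -> (psi \* h) x = 0.
  by move=> xr /=; rewrite psi0 ?mul0r// ltW.
exists (MkCinf (smooth_fun_extend Ac cph sub ph0)) => /=.
  have : nbhs a (ball a (r / 2 / 2)) by apply: nbhsx_ballx; rewrite divr_gt0.
  move=> /(near_chart_map cp); apply: filterS => q [cq].
  rewrite -ball_normE/= distrC => qa.
  by case: asboolP => // _; rewrite psi1 ?mul1r// ltW.
exists (fun q => if `[< chart_dom c q >] then psi (chart_map c q) else 0).
  move=> q; case: asboolP => cq; last by rewrite lexx ler01.
  split; first exact: psi01.
  move=> nUq; apply: psi0; rewrite leNgt; apply/negP => /ltW/inr/rU[_].
  by rewrite /= chart_mapK.
by move=> q; case: asboolP => // _; rewrite mul0r.
Qed.

Lemma Cinf_bump p (U : set M) : nbhs p U ->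
  exists phi : Cinf M, [/\ forall q, 0 <= phi q <= 1,
    \forall q \near p, phi q = 1 & forall q, ~ U q -> phi q = 0].
Proof.
move=> nU; have [c Ac cp] := atlas_cover p.
have [|f f1 [b b01 fb]] := @Cinf_extend c p (cst 1) U Ac cp _ nU.
  by move=> k; exact: Ck_cst openT.
exists f; split=> // q; rewrite fb mulr1; first by have [] := b01 q.
by have [_] := b01 q.
Qed.

Lemma Cinf_coord c p (j : 'I_n) : atlas c -> chart_dom c p ->
  exists f : Cinf M, \forall q \near p, f q = chart_map c q 0 j.
Proof.
move=> Ac cp; have [|f f1 _] :=
  @Cinf_extend c p (fun x : 'rV[R]_n => x 0 j) setT Ac cp _ filterT.
  by move=> k; exact: Ck_coord openT.
by exists f.
Qed.

(** With a bump function [phi] supported where [f] does not vanish,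
[f ^+ 2 + (1 - phi)] vanishes nowhere and is [f ^+ 2] near [p]. *)
Lemma Cinf_inv f p : f p != 0 ->
  exists g : Cinf M, \forall q \near p, f q * g q = 1.
Proof.
move=> fp; have nU : nbhs p [set q | f q != 0].
  apply: (@Cinf_continuous f p [set t : R | t != 0]).
  by apply: open_nbhs_nbhs; split => //; exact: open_neq.
have [phi [phi01 phi1 phi0]] := Cinf_bump nU.
pose D q := f q ^+ 2 + (1 - phi q).
have D0 q : 0 < D q.
  have [f0|f0] := eqVneq (f q) 0.
    by rewrite /D f0 expr0n/= add0r phi0 ?subr0//= f0 eqxx.
  rewrite /D ltr_pwDl ?exprn_even_gt0// subr_ge0.
  by have /andP[] := phi01 q.
have sD : (fun q => f q / D q) \in @smooth_fun R n M.
  apply/asboolP => c Ac k; have oc := @open_chart_img _ _ _ c.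
  have cf := Cinf_chart f k Ac; have cphi := Cinf_chart phi k Ac.
  apply: (CkM oc cf); apply: (Ck_inv oc); first by move=> x _; rewrite gt_eqF.
  exact: (CkD oc (CkM oc cf cf) (CkD oc (Ck_cst k 1 oc) (CkN oc cphi))).
exists (MkCinf sD); apply: filterS2 nU phi1 => q fq phiq /=.
by rewrite /D phiq subrr addr0 mulrA -expr2 mulfV// expf_neq0.
Qed.

End SmoothFunctions.

(** * Vector fields *)

Section VectorFields.
Context {R : realType} {n : nat} {M : manifold R n}.
Implicit Types (p q : M) (f g : Cinf M) (c d : chart R n M).

Lemma Cinf_evalD f g p : (f + g) p = f p + g p. Proof. by []. Qed.
Lemma Cinf_evalN f p : (- f) p = - f p. Proof. by []. Qed.
Lemma Cinf_evalM f g p : (f * g) p = f p * g p. Proof. by []. Qed.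

Lemma Cinf_eq f g : (forall p, f p = g p) -> f = g.
Proof. by move=> fg; apply: val_inj; apply/funext. Qed.

Definition eval_at p f : R := f p.

Lemma eval_at_zmod p : zmod_morphism (eval_at p). Proof. by []. Qed.
Lemma eval_at_monoid p : monoid_morphism (eval_at p). Proof. by []. Qed.

HB.instance Definition _ p :=
  GRing.isZmodMorphism.Build _ _ (eval_at p) (eval_at_zmod p).
HB.instance Definition _ p :=
  GRing.isMonoidMorphism.Build _ _ (eval_at p) (eval_at_monoid p).

Lemma Cinf_sum_eval I (r : seq I) (F : I -> Cinf M) p :
  (\sum_(i <- r) F i) p = \sum_(i <- r) F i p.
Proof. exact: (raddf_sum (eval_at p)). Qed.

Implicit Types (X Y : Cinf M -> Cinf M).

Lemma vector_field_add X f g p : vector_field X -> X (f + g) p = X f p + X g p.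
Proof.
move=> vX; have [c Ac cp] := atlas_cover p; have [u _ Xu] := vX c Ac.
have cm := chart_map_img cp; rewrite -(chart_mapK cp) !Xu//.
have oc := @open_chart_img _ _ _ c.
have [_ [df _]] := Cinf_chart f 1 Ac; have [_ [dg _]] := Cinf_chart g 1 Ac.
exact: (deriveD (df _ _ cm) (dg _ _ cm)).
Qed.

Lemma vector_fieldD X f g : vector_field X -> X (f + g) = X f + X g.
Proof. by move=> vX; apply: Cinf_eq => p; exact: vector_field_add. Qed.

Lemma vector_field0 X : vector_field X -> X 0 = 0.
Proof. by move=> vX; apply/(addrI (X 0)); rewrite -vector_fieldD// !addr0. Qed.

Lemma vector_fieldN X f : vector_field X -> X (- f) = - X f.
Proof.
by move=> vX; apply/(addrI (X f)); rewrite -vector_fieldD// !subrr vector_field0.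
Qed.

Lemma vector_field_lin f X Y : vector_field X -> vector_field Y ->
  vector_field (f \*o X \+ Y).
Proof.
move=> vX vY c Ac; have [u su Xu] := vX c Ac; have [w sw Yw] := vY c Ac.
have oc := @open_chart_img _ _ _ c.
exists (fun x => f (chart_inv c x) *: u x + w x).
  move=> j k; apply: (@Ck_ext _ _ _ _
    ((f \o chart_inv c) \* (fun x => u x 0 j) \+ (fun x => w x 0 j))) => //.
    by move=> x _; rewrite !mxE.
  by apply: CkD => //; [apply: CkM => //; [exact: Cinf_chart|exact: su]|exact: sw].
move=> h x cx; rewrite (derive_linear _ _ _ oc cx (Cinf_chart h 1 Ac)).
by rewrite -Xu// -Yw.
Qed.

Lemma vector_field_zero : vector_field (fun=> 0 : Cinf M).
Proof.
move=> c Ac; exists (fun=> 0).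
  move=> j k; have oc := @open_chart_img _ _ _ c.
  by apply: (Ck_ext oc _ (Ck_cst k 0 oc)) => x _; rewrite mxE.
by move=> f x cx; rewrite derive0.
Qed.

Lemma vector_field_lcomb I (r : seq I) (a : I -> Cinf M)
    (E : I -> Cinf M -> Cinf M) : (forall i, vector_field (E i)) ->
  vector_field (fun f => \sum_(i <- r) a i * E i f).
Proof.
move=> vE; elim: r => [|i r IH].
  rewrite (_ : (fun _ => _) = fun=> 0); first exact: vector_field_zero.
  by apply/funext => f; rewrite big_nil.
rewrite (_ : (fun _ => _) = a i \*o E i \+ (fun f => \sum_(i <- r) a i * E i f)).
  exact: vector_field_lin.
by apply/funext => f; rewrite big_cons.
Qed.

(** Coordinate functions cut off to be global smooth functions detect the
components of a tangent vector. *)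
Lemma components_unique c x (u w : 'rV[R]_n) : atlas c -> chart_img c x ->
  (forall f, 'D_u (f \o chart_inv c) x = 'D_w (f \o chart_inv c) x) -> u = w.
Proof.
move=> Ac cx H; apply/rowP => j.
have cp := chart_inv_dom cx; have [f fj] := Cinf_coord j Ac cp.
have E : \forall y \near x, (f \o chart_inv c) y = y 0 j.
  have := near_chart_inv cx fj; apply: filterS => y [cy /= ->].
  by rewrite chart_invK.
have := H f; rewrite !(near_eq_derive _ E).
by have [_ ->] := is_derive_coord x u j; have [_ ->] := is_derive_coord x w j.
Qed.

(** The components of the local fields agree where they overlap, so they define
smooth components in each chart. *)
Lemma vector_field_local X :
  (forall p, exists2 Y, vector_field Y & \forall q \near p, at_point X q = at_point Y q) ->
  vector_field X.
Proof.
move=> H c Ac; have oc := @open_chart_img _ _ _ c.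
have comp x : exists u : 'rV[R]_n, chart_img c x ->
    forall f, X f (chart_inv c x) = 'D_u (f \o chart_inv c) x.
  have [cx|] := pselect (chart_img c x); last by exists 0.
  have [Y vY XY] := H (chart_inv c x); have [u _ Yu] := vY c Ac.
  exists (u x) => _ f; rewrite -Yu//.
  by have /(congr1 (fun v => v f)) := nbhs_singleton XY.
have [u Xu] := choice comp.
exists u; last by move=> f x cx; exact: Xu.
move=> j k; apply: Ck_local => x cx.
have [Y vY XY] := H (chart_inv c x); have [w sw Yw] := vY c Ac.
have [V [oV Vx sV]] := open_chart_inv cx XY; exists V => //.
apply: (@Ck_ext _ _ _ _ (fun y => w y 0 j)) => //; last first.
  by apply: Ck_sub (sw j k) => y /sV[].
move=> y /sV[cy XYy]; suff -> : w y = u y by [].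
apply: (components_unique Ac cy) => f.
by rewrite -Xu// -Yw//; have /(congr1 (fun v => v f)) := XYy.
Qed.

Lemma vector_field_tangent X p : vector_field X -> tangent p (at_point X p).
Proof.
move=> vX; have [c Ac cp] := atlas_cover p; have [u _ Xu] := vX c Ac.
exists c, (u (chart_map c p)); split=> //; apply/funext => f.
by rewrite -Xu ?chart_mapK//; exact: chart_map_img.
Qed.

Lemma section_tangent X : vector_field X -> section (@tangent R n M) X.
Proof. by move=> vX; split=> // p; exact: vector_field_tangent. Qed.

End VectorFields.

(** * Sections of subbundles *)

Section Subbundles.
Context {R : realType} {n : nat} {M : manifold R n}.
Implicit Types (p q : M) (f g : Cinf M) (D : M -> set (Cinf M -> R)).

Lemma span_range k (w : 'I_k -> Cinf M -> R) v :
  Defs.span (range w) v <-> exists a, v = lcomb a w.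
Proof.
split=> [[l [a [w' [ww' ->]]]]|[a ->]]; last first.
  by exists k, a, w; split=> // i; exists i.
have /choice[s sw] : forall i, exists j, w j = w' i.
  by move=> i; have [j _ <-] := ww' i; exists j.
exists (fun j => \sum_(i < l | s i == j) a i); apply/funext => f.
rewrite /lcomb (partition_big s xpredT)//=; apply: eq_bigr => j _.
by rewrite mulr_suml; apply: eq_bigr => i /eqP <-; rewrite sw.
Qed.

Section OneBundle.
Variables (k : nat) (D : M -> set (Cinf M -> R)).
Hypothesis bD : subbundle k D.

Lemma subbundle_lin p (a : R) u v : D p u -> D p v -> D p (a \*o u \+ v).
Proof.
have [E [_ nE]] := bD p; have [_ ->] := nbhs_singleton nE.
move=> /span_range[b ->] /span_range[c ->]; apply/span_range.
exists (fun i => a * b i + c i); apply/funext => f /=.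
rewrite /lcomb mulr_sumr -big_split/=.
by apply: eq_bigr => i _; rewrite mulrDl mulrA.
Qed.

Lemma subbundle0 p : D p \0.
Proof.
have [E [_ nE]] := bD p; have [_ ->] := nbhs_singleton nE.
apply/span_range; exists (fun=> 0); apply/funext => f.
by rewrite /lcomb big1// => i _; rewrite mul0r.
Qed.

Lemma subbundleZ p (a : R) u : D p u -> D p (a \*o u).
Proof.
move=> Du; have := subbundle_lin a Du (subbundle0 p).
by rewrite (_ : _ \+ _ = a \*o u)//; apply/funext => f /=; rewrite addr0.
Qed.

Lemma subbundleD p u v : D p u -> D p v -> D p (u \+ v).
Proof.
move=> Du Dv; have := subbundle_lin 1 Du Dv.
by rewrite (_ : _ \+ _ = u \+ v)//; apply/funext => f /=; rewrite mul1r.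
Qed.

Lemma subbundleN p u : D p u -> D p (\- u).
Proof.
move=> Du; have := subbundleZ (-1) Du.
by rewrite (_ : _ \*o _ = \- u)//; apply/funext => f /=; rewrite mulN1r.
Qed.

Lemma subbundleB p u v : D p u -> D p v -> D p (u \- v).
Proof. by move=> Du /subbundleN; exact: subbundleD. Qed.

Lemma subbundle_lcomb p l (a : 'I_l -> R) w : (forall i, D p (w i)) ->
  D p (lcomb a w).
Proof.
move=> Dw; rewrite (_ : lcomb a w = fun f => \sum_(i < l) a i * w i f)//.
elim: (index_enum _) => [|i r IH].
  rewrite (_ : (fun _ => _) = \0); first exact: subbundle0.
  by apply/funext => f; rewrite big_nil.
rewrite (_ : (fun _ => _) = a i \*o w i \+ (fun f => \sum_(i <- r) a i * w i f)).
  exact: subbundle_lin.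
by apply/funext => f; rewrite big_cons.
Qed.

Lemma section_lcomb l (a : 'I_l -> Cinf M) E : (forall i, section D (E i)) ->
  section D (fun f => \sum_(i < l) a i * E i f).
Proof.
move=> sE; split; first by apply: vector_field_lcomb => i; have [] := sE i.
move=> p; rewrite (_ : at_point _ p = lcomb (fun i => a i p) (fun i => at_point (E i) p)).
  by apply: subbundle_lcomb => i; have [] := sE i.
by apply/funext => f; rewrite /at_point Cinf_sum_eval.
Qed.

(** The fields of a local frame lie in [D] only near [p]; multiplied by a bump
function they lie in [D] everywhere. *)
Lemma frame_sections p : exists E : 'I_k -> Cinf M -> Cinf M,
  (forall i, section D (E i)) /\
  \forall q \near p, lin_indep (fun i => at_point (E i) q) /\
    forall v, D q v -> exists a, v = lcomb a (fun i => at_point (E i) q).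
Proof.
have [E [vE nE]] := bD p; have [phi [phi01 phi1 phi0]] := Cinf_bump nE.
have EE i q : at_point (phi \*o E i) q = phi q \*o at_point (E i) q by [].
exists (fun i => phi \*o E i); split.
  move=> i; split.
    rewrite (_ : _ \*o _ = phi \*o E i \+ (fun=> 0)).
      by apply: vector_field_lin => //; exact: vector_field_zero.
    by apply/funext => f /=; rewrite addr0.
  move=> q; rewrite EE; have [[li Dq]|/phi0 ->] := pselect (lin_indep
      (fun i => at_point (E i) q) /\ D q = Defs.span (range (fun i => at_point (E i) q))).
    apply: subbundleZ; rewrite Dq; apply/span_range; exists (fun j => (j == i)%:R).
    apply/funext => f; rewrite /lcomb (bigD1 i)//= eqxx mul1r big1 ?addr0//.
    by move=> j /negPf ->; rewrite mul0r.
  rewrite (_ : _ \*o _ = \0); first exact: subbundle0.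
  by apply/funext => f /=; rewrite mul0r.
apply: filterS2 nE phi1 => q [li Dq] phiq.
rewrite (_ : (fun i => at_point (phi \*o E i) q) = fun i => at_point (E i) q).
  by split=> // v; rewrite Dq => /span_range.
by apply/funext => i; rewrite EE phiq; apply/funext => f /=; rewrite mul1r.
Qed.

End OneBundle.
End Subbundles.

Section Values.
Context {R : realType} {n : nat} {M : manifold R n}.
Implicit Types (p q : M) (f : Cinf M).

Lemma cst_smooth (a : R) : cst a \in @smooth_fun R n M.
Proof.
by apply/asboolP => c Ac k; apply: (Ck_cst k a); exact: open_chart_img.
Qed.

Definition Cinf_cst (a : R) : Cinf M := MkCinf (cst_smooth a).

Lemma section_value k (D : M -> set (Cinf M -> R)) p v : subbundle k D ->
  D p v -> exists2 X, section D X & at_point X p = v.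
Proof.
move=> bD Dv; have [E [sE nE]] := frame_sections bD p.
have [_ /(_ v Dv)[a va]] := nbhs_singleton nE.
exists (fun f => \sum_(i < k) Cinf_cst (a i) * E i f); first exact: section_lcomb.
by rewrite va; apply/funext => f; rewrite /at_point Cinf_sum_eval.
Qed.

End Values.

(** * The splitting of the tangent bundle and the horizontal projection *)

Section Splitting.
Context {R : realType} {n k m : nat} {M : manifold R n}.
Variables (H V : M -> set (Cinf M -> R)).
Hypotheses (bH : subbundle k H) (bV : subbundle m V) (HV : direct_sum H V).
Implicit Types (p q : M) (f : Cinf M) (A B X Y : Cinf M -> Cinf M).

Lemma H_V_eq0 p v : H p v -> V p v -> v = \0.
Proof.
by move=> Hv Vv; have [_ E] := HV p; have : (H p `&` V p) v by []; rewrite E.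
Qed.

Lemma bundle_projP p v : tangent p v ->
  H p (bundle_proj H V p v) /\ V p (v \- bundle_proj H V p v).
Proof.
move=> tv; have [/(_ v tv)[h Hh Vh] _] := HV p.
by apply: (@getPex _ [set h | H p h /\ V p (v \- h)]); exists h.
Qed.

Lemma tangent_value p v : tangent p v ->
  exists2 X, vector_field X & at_point X p = v.
Proof.
move=> tv; have [Hp Vp] := bundle_projP tv.
have [X [vX _] Xp] := section_value bH Hp; have [Y [vY _] Yp] := section_value bV Vp.
exists ((1 : Cinf M) \*o X \+ Y); first exact: vector_field_lin.
apply/funext => f; rewrite /at_point Cinf_evalD Cinf_evalM mul1r.
rewrite -[X f p]/(at_point X p f) -[Y f p]/(at_point Y p f) Xp Yp /=; ring.
Qed.

Lemma H_tangent p v : H p v -> tangent p v.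
Proof.
by move=> /(section_value bH)[X [vX _] <-]; exact: vector_field_tangent.
Qed.

Lemma V_tangent p v : V p v -> tangent p v.
Proof.
by move=> /(section_value bV)[X [vX _] <-]; exact: vector_field_tangent.
Qed.

Lemma tangent_lin p (a : R) u v : tangent p u -> tangent p v ->
  tangent p (a \*o u \+ v).
Proof.
move=> /tangent_value[X vX <-] /tangent_value[Y vY <-].
rewrite (_ : _ \+ _ = at_point (Cinf_cst a \*o X \+ Y) p)//.
by apply: vector_field_tangent; exact: vector_field_lin.
Qed.

Lemma tangent0 p : tangent p (\0 : Cinf M -> R).
Proof. exact: (vector_field_tangent p vector_field_zero). Qed.

Lemma tangent_lcomb p l (a : 'I_l -> R) w : (forall i, tangent p (w i)) ->
  tangent p (lcomb a w).
Proof.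
move=> Dw; rewrite (_ : lcomb a w = fun f => \sum_(i < l) a i * w i f)//.
elim: (index_enum _) => [|i r IH].
  rewrite (_ : (fun _ => _) = \0); first exact: tangent0.
  by apply/funext => f; rewrite big_nil.
rewrite (_ : (fun _ => _) = a i \*o w i \+ (fun f => \sum_(i <- r) a i * w i f)).
  exact: tangent_lin.
by apply/funext => f; rewrite big_cons.
Qed.

Variable g : M -> (Cinf M -> R) -> (Cinf M -> R) -> R.
Hypothesis (ig : smooth_inner_product (@tangent R n M) g).
Hypothesis gHV : forall p u v, H p u -> V p v -> g p u v = 0.

Lemma metricC p u v : tangent p u -> tangent p v -> g p u v = g p v u.
Proof. by move=> tu tv; have [ip _] := ig; have [+ _ _] := ip p; apply. Qed.

Lemma metric_lin p (a : R) u v w : tangent p u -> tangent p v -> tangent p w ->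
  g p (a \*o u \+ v) w = a * g p u w + g p v w.
Proof. by move=> tu tv tw; have [ip _] := ig; have [_ + _] := ip p; apply. Qed.

Lemma metric_eq0 p u : tangent p u -> g p u u = 0 -> u = \0.
Proof.
move=> tu gu; apply: contrapT => u0.
by have [ip _] := ig; have [_ _ /(_ u tu u0)] := ip p; rewrite gu ltxx.
Qed.

Lemma metric0 p w : tangent p w -> g p \0 w = 0.
Proof.
move=> tw; have := metric_lin 1 (tangent0 p) (tangent0 p) tw.
rewrite (_ : _ \+ _ = \0); last by apply/funext => f /=; rewrite mul1r addr0.
by move: (g p \0 w) => x; lra.
Qed.

Lemma metricD p u v w : tangent p u -> tangent p v -> tangent p w ->
  g p (u \+ v) w = g p u w + g p v w.
Proof.
move=> tu tv tw; rewrite -[g p u w]mul1r -metric_lin//; congr (g p _ w).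
by apply/funext => f /=; rewrite mul1r.
Qed.

Lemma metricB p u v w : tangent p u -> tangent p v -> tangent p w ->
  g p (u \- v) w = g p u w - g p v w.
Proof.
move=> tu tv tw; have := metric_lin (-1) tv tu tw.
rewrite (_ : _ \+ _ = u \- v); last by apply/funext => f /=; ring.
by move=> ->; ring.
Qed.

Lemma tangentB p u v : tangent p u -> tangent p v -> tangent p (u \- v).
Proof.
move=> tu tv; rewrite (_ : u \- v = (-1) \*o v \+ u); first exact: tangent_lin.
by apply/funext => f /=; ring.
Qed.

Lemma metricBr p u v w : tangent p u -> tangent p v -> tangent p w ->
  g p u (v \- w) = g p u v - g p u w.
Proof.
move=> tu tv tw; rewrite metricC//; last exact: tangentB.
by rewrite metricB// (metricC tu tv) (metricC tu tw).
Qed.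

Lemma metric_lcomb p l (a : 'I_l -> R) w v : (forall i, tangent p (w i)) ->
  tangent p v -> g p (lcomb a w) v = \sum_(i < l) a i * g p (w i) v.
Proof.
move=> tw tv.
suff [] : tangent p (fun f => \sum_(i < l) a i * w i f) /\
   g p (fun f => \sum_(i < l) a i * w i f) v = \sum_(i < l) a i * g p (w i) v by [].
elim: (index_enum _) => [|i r [IHt IH]].
  rewrite (_ : (fun _ => _) = \0); last by apply/funext => f; rewrite big_nil.
  by rewrite big_nil metric0//; split=> //; exact: tangent0.
rewrite (_ : (fun _ => _) = a i \*o w i \+ (fun f => \sum_(i <- r) a i * w i f)).
  by rewrite metric_lin// big_cons IH; split=> //; exact: tangent_lin.
by apply/funext => f; rewrite big_cons.
Qed.

Lemma pairingE X Y p : vector_field X -> vector_field Y ->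
  pairing g X Y p = g p (at_point X p) (at_point Y p).
Proof.
move=> vX vY; have [_ /(_ X Y (section_tangent vX) (section_tangent vY))] := ig.
by move=> s; rewrite /pairing -[LHS]/((\val (insubd _ _)) p) insubdK.
Qed.

(** In a local frame [E] of [H] the coefficients of the projection of [X] solve
the linear system given by the Gram matrix of [E], which is invertible because
the metric is definite; Cramer's formula shows that they are smooth. *)
Lemma bundle_proj_local X p : vector_field X ->
  exists2 Y, vector_field Y &
    \forall q \near p, bundle_proj H V q (at_point X q) = at_point Y q.
Proof.
move=> vX; have [E [sE nE]] := frame_sections bH p.
have vE i : vector_field (E i) by have [] := sE i.
have tE q i : tangent q (at_point (E i) q) by exact: vector_field_tangent.
pose G := \matrix_(i < k, j < k) pairing g (E i) (E j).
pose b := \row_(j < k) pairing g X (E j).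
have GE q i j : G i j q = g q (at_point (E i) q) (at_point (E j) q).
  by rewrite mxE pairingE.
have detp : (\det G) p != 0.
  rewrite -[_ p]/(eval_at p (\det G)) -det_map_mx.
  apply/det0P => -[a a0 aG]; move: a0; apply/negP; rewrite negbK; apply/eqP.
  have [li _] := nbhs_singleton nE.
  apply/rowP => i; rewrite mxE; apply: (li (fun i => a 0 i)).
  apply: (@metric_eq0 p); first exact: tangent_lcomb.
  rewrite metric_lcomb//; last exact: tangent_lcomb.
  apply: big1 => j _; rewrite metricC//; last exact: tangent_lcomb.
  rewrite metric_lcomb//; suff -> : \sum_(i < k) a 0 i *
      g p (at_point (E i) p) (at_point (E j) p) = 0 by rewrite mulr0.
  have := congr1 (fun A : 'rV_k => A 0 j) aG; rewrite !mxE => aG0.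
  by rewrite -[RHS]aG0; apply: eq_bigr => l _; rewrite mxE -GE.
have [dinv ndinv] := Cinf_inv detp.
pose a i := dinv * (b *m \adj G) 0 i.
exists (fun f => \sum_(i < k) a i * E i f); first exact: vector_field_lcomb.
apply: filterS2 nE ndinv => q [_ span_q] dq.
have tX := vector_field_tangent q vX.
have [Hh Vh] := bundle_projP tX; set h := bundle_proj _ _ _ _ in Hh Vh *.
have [al hal] := span_q _ Hh.
have bq : map_mx (eval_at q) b = (\row_i al i) *m map_mx (eval_at q) G.
  apply/rowP => j; rewrite !mxE; under eq_bigr do rewrite !mxE.
  rewrite /eval_at pairingE//; under eq_bigr do rewrite pairingE//.
  rewrite -metric_lcomb// -hal.
  rewrite (_ : at_point X q = (at_point X q \- h) \+ h); last first.
    by apply/funext => f /=; ring.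
  rewrite metricD//; [|exact: V_tangent|exact: H_tangent].
  have [_ /(_ q) HE] := sE j.
  by rewrite (metricC (V_tangent Vh) (tE q j)) (gHV HE Vh) add0r.
have aq i : a i q = al i.
  rewrite /a Cinf_evalM -[X in _ * X]/(eval_at q _).
  have -> : eval_at q ((b *m \adj G) 0 i) = map_mx (eval_at q) (b *m \adj G) 0 i.
    by rewrite [RHS]mxE.
  rewrite map_mxM bq map_mx_adj -mulmxA mul_mx_adj mul_mx_scalar !mxE.
  by rewrite det_map_mx mulrA mulrC [X in _ * X]mulrC dq mulr1.
rewrite hal; apply/funext => f; rewrite /lcomb /at_point Cinf_sum_eval.
by apply: eq_bigr => i _; rewrite Cinf_evalM aq.
Qed.

Definition bundle_proj_field X : Cinf M -> Cinf M :=
  fun f => insubd 0 (fun p => bundle_proj H V p (at_point X p) f).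

Lemma bundle_proj_fieldE X p : vector_field X ->
  at_point (bundle_proj_field X) p = bundle_proj H V p (at_point X p).
Proof.
move=> vX; apply/funext => f; rewrite /at_point /bundle_proj_field.
rewrite -[LHS]/((\val (insubd _ _)) p) insubdK//.
apply: smooth_fun_local => q; have [Y _ XY] := bundle_proj_local q vX.
by exists (Y f); apply: filterS XY => r /(congr1 (fun v => v f)).
Qed.

Lemma bundle_proj_section X : vector_field X -> section H (bundle_proj_field X).
Proof.
move=> vX; split; last first.
  by move=> p; rewrite bundle_proj_fieldE//;
    have [] := bundle_projP (vector_field_tangent p vX).
apply: vector_field_local => p; have [Y vY XY] := bundle_proj_local p vX.
by exists Y => //; apply: filterS XY => q <-; exact: bundle_proj_fieldE.
Qed.

Lemma bundle_proj_cosection X : vector_field X ->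
  section V (X \- bundle_proj_field X).
Proof.
move=> vX; have [vW _] := bundle_proj_section vX; split.
  rewrite (_ : _ \- _ = (- 1 : Cinf M) \*o bundle_proj_field X \+ X).
    exact: vector_field_lin.
  by apply/funext => f /=; rewrite mulN1r addrC.
move=> p; rewrite (_ : at_point _ p = at_point X p \- at_point (bundle_proj_field X) p)//.
rewrite bundle_proj_fieldE//.
by have [] := bundle_projP (vector_field_tangent p vX).
Qed.

End Splitting.

(** * Derivatives along varying directions and inverse matrices *)

Section DeriveAlong.
Context {R : realType} {n : nat}.
Implicit Types (U : set 'rV[R]_n) (f : 'rV[R]_n -> R) (x u v : 'rV[R]_n).

(** This is the product rule for [\sum_j (s y)_j * 'D_j f y], with the order of the
second derivatives exchanged. *)
Lemma is_derive_along U f (s : 'rV[R]_n -> 'rV[R]_n) x v : open U -> U x ->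
  Ck 2 U f -> (forall j, derivable (fun y => s y 0 j) x v) ->
  is_derive x v (fun y => 'D_(s y) f y)
    ('D_(\row_j 'D_v (fun y => s y 0 j) x) f x + 'D_(s x) (fun y => 'D_v f y) x).
Proof.
move=> oU Ux cf ds; have cf1 : Ck 1 U f by apply: Ck_le cf.
have [_ [_ Df]] := cf.
pose h j y := s y 0 j * 'D_(delta_mx 0 j) f y.
have E : \forall y \near x, \sum_j h j y = 'D_(s y) f y.
  by apply: (open_near_eq oU _ Ux) => y Uy; rewrite (derive_gradient _ oU Uy cf1).
apply: near_eq_is_derive E _.
have dh j : is_derive x v (h j) (s x 0 j * 'D_v (fun y => 'D_(delta_mx 0 j) f y) x
      + 'D_(delta_mx 0 j) f x * 'D_v (fun y => s y 0 j) x).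
  have [_ [dd _]] := Df (delta_mx 0 j).
  by apply: is_derive_eq (is_deriveM (derivableP (ds j)) (derivableP (dd x v Ux))) _.
rewrite (_ : (fun y => _) = \sum_j h j); last first.
  by apply/funext => y; rewrite fct_sumE.
apply: is_derive_eq (is_derive_sum dh) _.
rewrite (derive_gradient _ oU Ux cf1) (derive_gradient (s x) oU Ux (Df v)) -big_split/=.
have swap (a b c d : R) : a * b + c * d = d * c + a * b by ring.
apply: eq_bigr => j _; rewrite mxE (derive_commute (delta_mx 0 j) v oU Ux cf).
exact: swap.
Qed.

Lemma Ck_det k U l (A : 'I_l -> 'I_l -> 'rV[R]_n -> R) : open U ->
  (forall i j, Ck k U (A i j)) -> Ck k U (fun x => \det (\matrix_(i, j) A i j x)).
Proof.
move=> oU cA.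
apply: (@Ck_ext _ _ _ _ (fun x => \sum_(s : {perm 'I_l}) (-1) ^+ s * \prod_i A i (s i) x)) => //.
  move=> x _; apply: eq_bigr => s _; congr (_ * _).
  by apply: eq_bigr => i _; rewrite mxE.
apply: Ck_sum => // s; apply: (CkM oU (Ck_cst k _ oU)).
by apply: Ck_prod.
Qed.

(** By Cramer's formula the entries are quotients of determinants. *)
Lemma Ck_invmx k U l (A : 'I_l -> 'I_l -> 'rV[R]_n -> R) : open U ->
  (forall x, U x -> \det (\matrix_(i, j) A i j x) != 0) ->
  (forall i j, Ck k U (A i j)) ->
  forall i j, Ck k U (fun x => invmx (\matrix_(i, j) A i j x) i j).
Proof.
move=> oU A0 cA i j.
apply: (@Ck_ext _ _ _ _ (fun x => (\det (\matrix_(i, j) A i j x))^-1 *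
   ((-1) ^+ (j + i) * \det (\matrix_(a, b) A (lift j a) (lift i b) x)))) => //.
  move=> x Ux; rewrite /invmx unitmxE unitfE A0// !mxE /cofactor; congr (_ * (_ * \det _)).
  by apply/matrixP => a b; rewrite !mxE.
apply: CkM => //; first by apply: Ck_inv => //; exact: Ck_det.
by apply: (CkM oU (Ck_cst k _ oU)); exact: Ck_det.
Qed.

End DeriveAlong.

(** * Brackets of sections of an integrable distribution *)

Section Integrable.
Context {R : realType} {n m : nat} {M : manifold R n}.
Implicit Types (f : Cinf M) (W : set 'rV[R]_m) (iota : 'rV[R]_m -> M).

(** The differentials at a point of the smooth functions restricted to an
immersed submanifold separate its tangent vectors, so they contain a basis of
the cotangent space. *)
Lemma immersion_coordinates W iota w :
  (forall f, smooth_on W (f \o iota)) -> W w ->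
  (forall a, (forall f, 'D_a (f \o iota) w = 0) -> a = 0) -> open W ->
  exists F : 'I_m -> Cinf M,
    \det (\matrix_(i, j) 'D_(delta_mx 0 i) (F j \o iota) w) != 0.
Proof.
move=> sf Ww imm oW.
pose d f : 'cV[R]_m := \col_i 'D_(delta_mx 0 i) (f \o iota) w.
have dE a f : 'D_a (f \o iota) w = (a *m d f) 0 0.
  rewrite (derive_gradient _ oW Ww (sf f 1)) mxE.
  by apply: eq_bigr => i _; rewrite mxE.
have [F rF] : exists F : 'I_m -> Cinf M, \rank (\matrix_(i, j) d (F i) j 0) = m.
  suff : forall r, (r <= m)%N -> exists F : 'I_r -> Cinf M,
      \rank (\matrix_(i, j) d (F i) j 0) = r.
    by move=> /(_ m (leqnn m)).
  elim=> [|r IH] rm.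
    by exists (fun=> 0); apply/eqP; rewrite -leqn0 rank_leq_row.
  have [F rF] := IH (ltnW rm); set A := \matrix_(_, _) _ in rF.
  have [a a0 Aa] : exists2 a : 'rV_m, a != 0 & a *m A^T = 0.
    have : kermx A^T != 0 by rewrite -mxrank_eq0 mxrank_ker mxrank_tr rF subn_eq0 -ltnNge.
    by move=> /rowV0Pn[a /sub_kermxP aA a0]; exists a.
  have [f fa] : exists f, 'D_a (f \o iota) w != 0.
    apply: contrapT => /forallNP H; move: a0 => /eqP; apply; apply: imm => f.
    by apply/eqP; rewrite -[_ == _]negbK; apply/negP; exact: H.
  rewrite -addn1; exists (fun i => match fintype.split i with inl j => F j | inr _ => f end).
  pose l : 'rV[R]_m := \row_j d f j 0.
  rewrite (_ : \matrix_(i, j) _ = col_mx A l); last first.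
    by apply/matrixP => i j; rewrite !mxE; case: fintype.split => b; rewrite !mxE.
  apply/eqP; apply: inj_row_free => v; rewrite -[v]hsubmxK.
  move: (lsubmx v) (rsubmx v) => x y; rewrite mul_row_col => xy0.
  have la : (l *m a^T) 0 0 != 0.
    suff -> : (l *m a^T) 0 0 = 'D_a (f \o iota) w by [].
    have -> : l *m a^T = (a *m d f)^T.
      by rewrite trmx_mul; congr (_ *m _); apply/rowP => j; rewrite !mxE.
    by rewrite dE [LHS]mxE.
  have Aa' : A *m a^T = 0 by rewrite -[LHS]trmxK trmx_mul trmxK Aa trmx0.
  have y0 : y = 0.
    have := congr1 (fun B => (B *m a^T) 0 0) xy0.
    rewrite mulmxDl -!mulmxA Aa' mulmx0 add0r mul0mx mxE big_ord1 [RHS]mxE.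
    move=> /eqP; rewrite mulf_eq0 (negPf la) orbF => /eqP y00.
    by apply/matrixP => i j; rewrite !ord1 y00 mxE.
  move: xy0; rewrite y0 mul0mx addr0 => xA0.
  have fA : row_free A by rewrite /row_free rF.
  by rewrite (row_free_inj fA (etrans xA0 (esym (mul0mx _ A)))) row_mx0.
exists F; rewrite -unitfE -unitmxE -row_full_unit.
rewrite (_ : \matrix_(i, j) _ = (\matrix_(i, j) d (F i) j 0)^T).
  by rewrite /row_full mxrank_tr rF.
by apply/matrixP => i j; rewrite !mxE.
Qed.

(** A vector field tangent to an immersed submanifold is smooth in the parameters:
its components are found by inverting a Jacobian matrix. *)
Lemma tangent_components_smooth W iota w (S : Cinf M -> Cinf M)
    (s : 'rV[R]_m -> 'rV[R]_m) k :
  open W -> W w -> (forall f, smooth_on W (f \o iota)) ->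
  (forall a, (forall f, 'D_a (f \o iota) w = 0) -> a = 0) ->
  (forall w', W w' -> forall f, S f (iota w') = 'D_(s w') (f \o iota) w') ->
  exists N, [/\ open N, N w & forall j, Ck k N (fun w' => s w' 0 j)].
Proof.
move=> oW Ww sf imm Ss.
have [F F0] := immersion_coordinates sf Ww imm oW.
pose J i j w' := 'D_(delta_mx 0 i) (F j \o iota) w'.
have cJ l i j : Ck l W (J i j) by have [_ [_]] := sf (F j) l.+1; apply.
pose dJ w' := \det (\matrix_(i, j) J i j w').
have cdJ : {for w, continuous dJ}.
  by have [+ _] := Ck_det oW (cJ 0%N); apply.
have nN : nbhs w [set w' | W w' /\ dJ w' != 0].
  apply: filterI; first exact: open_nbhs_nbhs.
  apply: (cdJ [set t : R | t != 0]).
  by apply: open_nbhs_nbhs; split => //; exact: open_neq.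
pose N := interior [set w' | W w' /\ dJ w' != 0].
have oN : open N by exact: open_interior.
have NW w' : N w' -> W w' by move=> /interior_subset[].
have N0 w' : N w' -> dJ w' != 0 by move=> /interior_subset[].
exists N; split=> // j.
apply: (@Ck_ext _ _ _ _ (fun w' => \sum_l (S (F l) \o iota) w' *
   invmx (\matrix_(i, j) J i j w') l j)) => //.
  move=> w' Nw; have Ww' := NW _ Nw.
  have sJ : s w' *m (\matrix_(i, j) J i j w') = \row_l S (F l) (iota w').
    apply/rowP => l; rewrite !mxE Ss// (derive_gradient _ oW Ww' (sf (F l) 1)).
    by apply: eq_bigr => i _; rewrite mxE.
  have uJ : (\matrix_(i, j) J i j w') \in unitmx by rewrite unitmxE unitfE; exact: N0.
  rewrite -[s w'](mulmxK uJ) sJ mxE.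
  by apply: eq_bigr => l _; rewrite mxE.
apply: Ck_sum => // l; apply: CkM => //; first exact: Ck_sub (sf (S (F l)) k).
by apply: Ck_invmx => // i b; exact: Ck_sub (cJ k i b).
Qed.

(** On an integral manifold parametrized by [iota] the two fields are images of
fields [s] and [t] of parameters. The second derivatives of [f \o iota] cancel by
symmetry, and what remains of the bracket is the image of the bracket of [s] and
[t]. *)
Lemma integrable_bracket (V : M -> set (Cinf M -> R)) S T p :
  integrable_distribution m V -> section V S -> section V T ->
  V p (at_point (bracket S T) p).
Proof.
move=> iV [vS VS] [vT VT]; have [W [iota [oW [w Ww wp] [_ sf] [_ imm] Vi]]] := iV p.
have comp (A : Cinf M -> Cinf M) : (forall q, V q (at_point A q)) -> exists a : 'rV[R]_m -> 'rV[R]_m,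
    forall w', W w' -> forall f, A f (iota w') = 'D_(a w') (f \o iota) w'.
  move=> VA; have /choice[a Ha] : forall w', exists a : 'rV[R]_m, W w' ->
      forall f, A f (iota w') = 'D_a (f \o iota) w'.
    move=> w'; have [Ww'|] := pselect (W w'); last by exists 0.
    have := VA (iota w'); rewrite Vi// => -[a _ aA].
    by exists a => _ f; have /(congr1 (fun v => v f)) := aA.
  by exists a.
have [s Hs] := comp S VS; have [t Ht] := comp T VT.
have der (A : Cinf M -> Cinf M) a v : (forall w', W w' -> forall f, A f (iota w') = 'D_(a w') (f \o iota) w') ->
    forall f, 'D_v (A f \o iota) w =
    'D_(\row_j 'D_v (fun y => a y 0 j) w) (f \o iota) w +
    'D_(a w) (fun y => 'D_v (f \o iota) y) w.
  move=> HA f; have [N [oN Nw ca]] :=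
    tangent_components_smooth 1 oW Ww sf (imm w ^~ Ww) HA.
  have da j : derivable (fun y => a y 0 j) w v.
    by have [_ [d _]] := ca j; exact: d.
  have [_ <-] := is_derive_along oW Ww (sf f 2) da.
  apply: near_eq_derive; apply: (open_near_eq oW _ Ww) => y Wy.
  exact: HA.
rewrite -wp Vi//.
exists (\row_j 'D_(s w) (fun y => t y 0 j) w - \row_j 'D_(t w) (fun y => s y 0 j) w) => //.
apply/funext => f; rewrite /at_point.
have -> : bracket S T f (iota w) = S (T f) (iota w) - T (S f) (iota w) by [].
rewrite Hs// Ht// (der T t (s w) Ht f) (der S s (t w) Hs f).
rewrite (derive_commute (s w) (t w) oW Ww (sf f 2)).
rewrite addrC -scaleN1r (derive_linear _ _ _ oW Ww (sf f 1)).
move: ('D__ _ _) ('D__ _ _) ('D__ _ _) => a b c; ring.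
Qed.

End Integrable.

(** * Minima of smooth functions *)

Section CriticalPoints.
Context {R : realType} {n : nat} {M : manifold R n}.

(** At a critical point the derivative of the components of [X] contributes nothing
to [X (X f)], which is then a second derivative in a constant direction. *)
Lemma vector_field_at_min (X : Cinf M -> Cinf M) (f : Cinf M) (p : M) :
  vector_field X -> (forall q, f p <= f q) -> X f p = 0 /\ 0 <= X (X f) p.
Proof.
move=> vX fmin; have [c Ac cp] := atlas_cover p; have [u su Xu] := vX c Ac.
have oc := @open_chart_img _ _ _ c; have cx := chart_map_img cp.
set x := chart_map c p in cx; have px : p = chart_inv c x by rewrite chart_mapK.
have cf l := Cinf_chart f l Ac.
have fx y : chart_img c y -> (f \o chart_inv c) x <= (f \o chart_inv c) y.
  by rewrite /= -px.
have D0 v : 'D_v (f \o chart_inv c) x = 0 := derive_at_min v oc cx (cf 1%N) fx.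
split; first by rewrite px Xu.
rewrite px Xu//.
have E : \forall y \near x, (X f \o chart_inv c) y = 'D_(u y) (f \o chart_inv c) y.
  by apply: (open_near_eq oc _ cx) => y cy; rewrite /= Xu.
rewrite (near_eq_derive _ E).
have [j|_ ->] := is_derive_along (v := u x) (s := u) oc cx (cf 2%N).
  by have [_ [d _]] := su j 1%N; exact: d.
by rewrite D0 add0r; exact: (second_derive_at_min (u x) oc cx (cf 2%N) fx).
Qed.

Lemma Cinf_min (f : Cinf M) : [set: M] !=set0 -> compact [set: M] ->
  exists p, forall q, f p <= f q.
Proof.
move=> M0 cM; have [|p _ pmin] := @compact_EVT_min _ _ (f : M -> R) _ M0 cM.
  exact/continuous_subspaceT/Cinf_continuous.
by exists p => q; apply: pmin; rewrite inE.
Qed.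

End CriticalPoints.

(** * The horizontal part of a Killing field *)

Section HorizontalKilling.
Context {R : realType} {n k m : nat} {M : manifold R n}.
Variables (H V : M -> set (Cinf M -> R)).
Variables (ip g : M -> (Cinf M -> R) -> (Cinf M -> R) -> R).
Variables (nabla : (Cinf M -> Cinf M) -> (Cinf M -> Cinf M) -> Cinf M -> Cinf M).
Hypotheses (bH : subbundle k H) (bV : subbundle m V) (HV : direct_sum H V).
Hypothesis (g_ext : riemannian_extension H V ip g).
Hypothesis (can : canonical_connection H V g nabla).
Variable K : Cinf M -> Cinf M.
Hypothesis (K_killing : H_killing H V ip K).

Implicit Types (p q : M) (A B X Y T : Cinf M -> Cinf M).

Let ig : smooth_inner_product (@tangent R n M) g.
Proof. by have [] := g_ext. Qed.

Let g_ip p u v : H p u -> H p v -> g p u v = ip p u v.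
Proof. by have [_ + _] := g_ext; apply. Qed.

Let gHV p u v : H p u -> V p v -> g p u v = 0.
Proof. by have [_ _] := g_ext; apply. Qed.

Let vK : vector_field K. Proof. by have [] := K_killing. Qed.

Local Notation W := (bundle_proj_field H V K).
Local Notation KV := (K \- bundle_proj_field H V K).

Let sW : section H W.
Proof. exact (bundle_proj_section bH bV HV ig gHV vK). Qed.

Let sKV : section V KV.
Proof. exact (bundle_proj_cosection bH bV HV ig gHV vK). Qed.

Let vW : vector_field W. Proof. by have [] := sW. Qed.
Let vKV : vector_field KV. Proof. by have [] := sKV. Qed.

Lemma nabla_vf A B : vector_field A -> vector_field B -> vector_field (nabla A B).
Proof. by have [+ _ _ _] := canonical_is_connection can; apply. Qed.

Lemma nablaBl A A' B : vector_field A -> vector_field A' -> vector_field B ->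
  nabla (A \- A') B = nabla A B \- nabla A' B.
Proof.
move=> vA vA' vB; have [_ + _ _] := canonical_is_connection can.
move=> /(_ (-1) A' A B vA' vA vB); rewrite (_ : _ \+ _ = A \- A'); last first.
  by apply/funext => f /=; rewrite mulN1r addrC.
by move=> ->; apply/funext => f /=; rewrite mulN1r addrC.
Qed.

Lemma nablaDl A A' B : vector_field A -> vector_field A' -> vector_field B ->
  nabla (A \+ A') B = nabla A B \+ nabla A' B.
Proof.
move=> vA vA' vB; have [_ + _ _] := canonical_is_connection can.
move=> /(_ 1 A A' B vA vA' vB); rewrite (_ : (1 : Cinf M) \*o A \+ A' = A \+ A'); last first.
  by apply/funext => f /=; rewrite mul1r.
by move=> ->; apply/funext => f /=; rewrite mul1r.
Qed.

Lemma nablaH A X : vector_field A -> section H X -> section H (nabla A X).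
Proof. by move=> vA sX; exact (canonical_parallelH can vA sX). Qed.

Lemma nablaV A X : vector_field A -> section V X -> section V (nabla A X).
Proof. by move=> vA sX; exact (canonical_parallelV can vA sX). Qed.

Let K_split : W \+ KV = K.
Proof. by apply/funext => f /=; rewrite addrC subrK. Qed.

Lemma bracket_proj T : vector_field T ->
  bracket W T = bracket K T \- bracket KV T.
Proof.
move=> vT; apply/funext => f; rewrite /bracket /= (vector_fieldD _ _ vT) (vector_fieldN _ vT).
ring.
Qed.

(** [nabla T W] is horizontal, and it is the difference of [nabla W T], the bracket
of [W] and [T], and their torsion. The bracket is vertical, because [K]
preserves [V] and the vertical part of [K] is a section of the integrable [V];
the torsion is vertical by normality. *)
Lemma nabla_vertical (Hn : H_normal H V nabla) (iV : integrable_distribution m V) T p :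
  section V T -> at_point (nabla T W) p = \0.
Proof.
move=> sT; have [vT _] := sT.
apply: (H_V_eq0 HV); first by have [_] := nablaH vT sW.
have [_ KT _] : [/\ True, section V (bracket K T) & True].
  by have [_ _ + _] := K_killing => /(_ T sT).
have KVT := integrable_bracket p iV sKV sT.
have [_ TWT] := Hn W T sW sT.
have [_ WT] := nablaV vW sT.
have E : at_point (nabla T W) p = at_point (nabla W T) p \-
    (at_point (bracket K T) p \- at_point (bracket KV T) p)
    \- at_point (torsion nabla W T) p.
  apply/funext => f; rewrite /torsion bracket_proj//.
  rewrite -[RHS]/(nabla W T f p - (bracket K T f p - bracket KV T f p) -
    (nabla W T f p - nabla T W f p - (bracket K T f p - bracket KV T f p))).
  rewrite /at_point; ring.
rewrite E; apply: (subbundleB bV); last exact: TWT.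
by apply: (subbundleB bV) (WT p) _; apply: (subbundleB bV) KVT; have [] := KT.
Qed.

(** The difference of the two sides is horizontal, since [K] preserves [H]; written
with the torsions of [X] with the two parts of [K] and the derivative along [X]
of the vertical part, it is vertical. *)
Lemma bracket_killing (Hn : H_normal H V nabla) X p : section H X ->
  at_point (bracket K X) p = at_point (nabla K X) p \- at_point (nabla X W) p.
Proof.
move=> sX; have [vX _] := sX.
pose u := at_point (nabla K X) p \- at_point (nabla X W) p \- at_point (bracket K X) p.
suff u0 : u = \0.
  by apply/funext => f; have := congr1 (fun v => v f) u0; rewrite /u /=; lra.
apply: (H_V_eq0 HV).
  apply: (subbundleB bH); last by have [_ + _ _] := K_killing => /(_ X sX)[].
  have [_ HKX] := nablaH vK sX; have [_ HXW] := nablaH vX sW.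
  exact (subbundleB bH (HKX p) (HXW p)).
have -> : u = at_point (torsion nabla W X) p \- at_point (torsion nabla X KV) p
    \+ at_point (nabla X KV) p.
  have nK : nabla K X = nabla W X \+ nabla KV X by rewrite -nablaDl// K_split.
  apply/funext => f; rewrite /u nK.
  rewrite /torsion bracket_proj//.
  rewrite -[LHS]/(nabla W X f p + nabla KV X f p - nabla X W f p - bracket K X f p).
  rewrite -[RHS]/((nabla W X f p - nabla X W f p - (bracket K X f p - bracket KV X f p))
    - (nabla X KV f p - nabla KV X f p - bracket X KV f p) + nabla X KV f p).
  have -> : bracket X KV f p = - bracket KV X f p.
    exact (esym (opprB (KV (X f) p) (X (KV f) p))).
  ring.
have [_ tWX] := canonical_torHH can sW sX.
have [_ tXV] := Hn X KV sX sKV.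
have [_ nXV] := nablaV vX sKV.
by apply: (subbundleD bV) (nXV p); exact: (subbundleB bV).
Qed.

Lemma pairing_ip X Y : section H X -> section H Y -> pairing ip X Y = pairing g X Y.
Proof.
move=> [_ HX] [_ HY]; rewrite /pairing; congr insubd; apply/funext => p.
by rewrite g_ip.
Qed.

(** Subtract the Killing equation from the compatibility of [nabla] with the metric:
by [bracket_killing] only the terms in [W] remain. *)
Lemma nabla_skew (Hn : H_normal H V nabla) X Y p : section H X -> section H Y ->
  g p (at_point (nabla X W) p) (at_point Y p) =
  - g p (at_point X p) (at_point (nabla Y W) p).
Proof.
move=> sX sY; have [vX _] := sX; have [vY _] := sY.
have [_ KH _ Kip] := K_killing.
have sKX := KH X sX; have sKY := KH Y sY.
have [vKX _] := sKX; have [vKY _] := sKY.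
have := Kip X Y sX sY; rewrite !pairing_ip//.
have -> := canonical_metric can vK vX vY.
move=> /(congr1 (fun f : Cinf M => f p)); rewrite !Cinf_evalD.
have v1 := nabla_vf vK vX; have v2 := nabla_vf vK vY.
have v3 := nabla_vf vX vW; have v4 := nabla_vf vY vW.
rewrite !(pairingE ig)// !bracket_killing//.
have t X' : vector_field X' -> tangent p (at_point X' p).
  exact: vector_field_tangent.
rewrite (metricB ig) ?(metricBr bH bV HV ig); try exact: t.
by move: (g p _ _) (g p _ _) (g p _ _) (g p _ _) => a b c d; lra.
Qed.

Hypotheses (Hn : H_normal H V nabla) (iV : integrable_distribution m V).

Let t_ p A : vector_field A -> tangent p (at_point A p).
Proof. exact: vector_field_tangent. Qed.

Let H_eq0 p v : H p v -> (forall Y, section H Y -> g p v (at_point Y p) = 0) -> v = \0.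
Proof.
move=> Hv v0; apply: (metric_eq0 ig); first exact (H_tangent bH Hv).
by have [Y sY Yp] := section_value bH Hv; rewrite -{2}Yp; exact: v0.
Qed.

(** Skew-symmetry replaces the derivative of [W] along [X] by its derivative along
itself: the horizontal gradient of the squared length of [W] is [- 2 nabla W W]. *)
Lemma norm_derivative X : section H X ->
  X (pairing g W W) = - (pairing g (nabla W W) X + pairing g (nabla W W) X).
Proof.
move=> sX; have [vX _] := sX; rewrite (canonical_metric can vX vW vW).
have vXW := nabla_vf vX vW; have vWW := nabla_vf vW vW.
apply: Cinf_eq => p; rewrite Cinf_evalN !Cinf_evalD !(pairingE ig)//.
rewrite (metricC ig (t_ p vW) (t_ p vXW)) (nabla_skew Hn p sX sW).
rewrite (metricC ig (t_ p vX) (t_ p vWW)); ring.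
Qed.

Section AtMinimum.
Variable p : M.
Hypothesis W_min : forall q, pairing g W W p <= pairing g W W q.

Lemma min_nablaW X : section H X -> g p (at_point (nabla X W) p) (at_point W p) = 0.
Proof.
move=> sX; have [vX _] := sX; have [X0 _] := vector_field_at_min vX W_min.
move: X0; rewrite norm_derivative// Cinf_evalN Cinf_evalD (pairingE ig)//; last exact: nabla_vf.
rewrite (nabla_skew Hn p sX sW)// (metricC ig (t_ p vX)); last exact/t_/nabla_vf.
by move: (g p _ _) => a; lra.
Qed.

Lemma min_nablaWW : at_point (nabla W W) p = \0.
Proof.
apply: H_eq0 => [|Y sY]; first by have [_] := nablaH vW sW; apply.
have [vY _] := sY; have vYW := nabla_vf vY vW.
rewrite (nabla_skew Hn p sW sY)// (metricC ig (t_ p vW) (t_ p vYW)).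
by rewrite (min_nablaW sY) oppr0.
Qed.

(** The second derivative along [X] of the squared length of [W] is
[- 2 <nabla X (nabla W W), X>] at [p], because [nabla W W] vanishes there. The two
other terms of the curvature vanish as well: [nabla W (nabla X W)] pairs with [X]
to zero since [nabla X W] is orthogonal to [X] everywhere and zero at [p], and
the derivative along the bracket decomposes by the torsion, whose vertical
contribution is zero and whose other contributions pair with [X], by
skew-symmetry, as vectors do with [nabla X W]. *)
Lemma min_curvature X : section H X -> at_point (nabla X W) p = \0 ->
  ip p (at_point (curvature nabla X W W) p) (at_point X p) <= 0.
Proof.
move=> sX X0; have [vX HX] := sX.
have sXW := nablaH vX sW; have [vXW _] := sXW.
have sWX := nablaH vW sX; have [vWX _] := sWX.
have sWW := nablaH vW sW; have [vWW _] := sWW.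
have [vT _] := canonical_torHH can sX sW.
have sT := canonical_torHH can sX sW.
have br : bracket X W = (nabla X W \- nabla W X) \- torsion nabla X W.
  apply/funext => f.
  exact (esym (subKr (nabla X W f - nabla W X f) (bracket X W f))).
have vXWX : vector_field (nabla X W \- nabla W X).
  rewrite (_ : _ \- _ = (-1 : Cinf M) \*o nabla W X \+ nabla X W); first exact: vector_field_lin.
  by apply/funext => f /=; rewrite mulN1r addrC.
have vXXW := nabla_vf vX vWW; have vWXW := nabla_vf vW vXW.
have sA := nablaH vXW sW; have sB := nablaH vWX sW.
have [vA HA] := sA; have [vB HB] := sB.
have RE : at_point (curvature nabla X W W) p =
    (at_point (nabla X (nabla W W)) p \- at_point (nabla W (nabla X W)) p) \-
    (at_point (nabla (nabla X W) W) p \- at_point (nabla (nabla W X) W) p).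
  apply/funext => f; rewrite /curvature br nablaBl// nablaBl//.
  have /(congr1 (fun v => v f)) T0 := nabla_vertical Hn iV p sT.
  rewrite -[LHS]/((nabla X (nabla W W) f p - nabla W (nabla X W) f p) -
    ((nabla (nabla X W) W f p - nabla (nabla W X) W f p) -
     at_point (nabla (torsion nabla X W) W) p f)) T0 subr0.
  reflexivity.
have HR : H p (at_point (curvature nabla X W W) p).
  rewrite RE; do 2 apply: (subbundleB bH) => //; try exact: HA; try exact: HB.
    by have [_] := nablaH vX sWW.
  by have [_] := nablaH vW sXW.
rewrite -g_ip// RE.
have h1 := t_ p vXXW; have h2 := t_ p vWXW; have h3 := t_ p vA; have h4 := t_ p vB.
have h5 := t_ p vX.
have tB := tangentB bH bV HV.
rewrite (metricB ig)//; [|exact: tB|exact: tB]; rewrite !(metricB ig)//.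
have -> : g p (at_point (nabla (nabla X W) W) p) (at_point X p) = 0.
  by rewrite (nabla_skew Hn p sXW sX)// X0 (metric0 ig) ?oppr0//; exact (tangent0 p).
have -> : g p (at_point (nabla (nabla W X) W) p) (at_point X p) = 0.
  have h6 := t_ p vWX.
  by rewrite (nabla_skew Hn p sWX sX)// X0 (metricC ig h6 (tangent0 p)) (metric0 ig) ?oppr0.
have -> : g p (at_point (nabla W (nabla X W)) p) (at_point X p) = 0.
  have P0 : pairing g (nabla X W) X = 0.
    apply: Cinf_eq => q; rewrite (pairingE ig)//.
    have := nabla_skew Hn q sX sX; rewrite (metricC ig (t_ q vX) (t_ q vXW)).
    by rewrite -[(0 : Cinf M) q]/(0 : R); move: (g q _ _) => a; lra.
  have := canonical_metric can vW vXW vX; rewrite P0 (vector_field0 vW).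
  move=> /(congr1 (fun f : Cinf M => f p)); rewrite Cinf_evalD !(pairingE ig)//.
  rewrite X0 (metric0 ig); last exact: t_.
  by rewrite addr0 => <-.
have [_] := vector_field_at_min vX W_min.
rewrite norm_derivative// (vector_fieldN _ vX) (vector_fieldD _ _ vX).
rewrite (canonical_metric can vX vWW vX) Cinf_evalN !Cinf_evalD !(pairingE ig)//; last exact: nabla_vf.
rewrite min_nablaWW (metric0 ig); last exact/t_/nabla_vf.
by move: (g p _ _) => a; lra.
Qed.

(** Exchanging one field of a frame of [H] for [W] leaves an odd number of fields
besides [W], and a skew-symmetric matrix of odd size is singular. *)
Lemma kernel_direction : ~~ odd k -> at_point W p <> \0 ->
  exists2 X, section H X & at_point (nabla X W) p = \0 /\
    lin_indep (tnth [tuple at_point X p; at_point W p]).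
Proof.
move=> ke W0; have [E [sE nE]] := frame_sections bH p.
have [li sp] := nbhs_singleton nE.
have [_ HW] := sW; have [w Ww] := sp _ (HW p).
have vE i : vector_field (E i) by have [] := sE i.
have tE i : tangent p (at_point (E i) p) by exact: t_.
have [i0 w0] : exists i0, w i0 != 0.
  apply: contrapT => /forallNP w0; apply: W0; rewrite Ww; apply/funext => f.
  rewrite /lcomb big1// => i _.
  by have /negP := w0 i; rewrite negbK => /eqP ->; rewrite mul0r.
pose E' j := E (lift i0 j).
have vE'W j : vector_field (nabla (E' j) W) by apply: nabla_vf => //; exact: vE.
pose B := \matrix_(i, j) g p (at_point (nabla (E' i) W) p) (at_point (E' j) p).
have BT : B^T = (-1) *: B.
  apply/matrixP => i j; rewrite !mxE (nabla_skew Hn p (sE _) (sE _)) mulN1r.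
  by rewrite (metricC ig (tE _) (t_ p (vE'W i))).
have B0 : \det B = 0.
  have := det_tr B; rewrite BT detZ -signr_odd.
  have -> : odd k.-1.
    have k0 : (0 < k)%N by apply: leq_trans (ltn_ord i0).
    by move: ke; rewrite -{1}(prednK k0) /= negbK.
  by rewrite expr1 mulN1r => /eqP; rewrite eq_sym -addr_eq0 -mulr2n mulrn_eq0 => /eqP.
have /eqP/det0P[y y0 yB] := B0.
(* The coordinate along the exchanged field is zero, so that [X] is independent of
   [W], whose coordinate there is not. *)
pose x i : R := if unlift i0 i is Some j then y 0 j else 0.
have x0 : x i0 = 0 by rewrite /x unlift_none.
have xl j : x (lift i0 j) = y 0 j by rewrite /x liftK.
pose X f := \sum_(i < k) Cinf_cst (x i) * E i f.
have sX : section H X by exact (section_lcomb bH (fun i => Cinf_cst (x i)) sE).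
have [vX HX] := sX.
have Xp : at_point X p = lcomb x (fun i => at_point (E i) p).
  by apply/funext => f; rewrite /at_point Cinf_sum_eval.
exists X => //; split.
  have sXW := nablaH vX sW; have [vXW HXW] := sXW.
  set z := at_point (nabla X W) p.
  have tz : tangent p z by exact: t_.
  have zE' j : g p z (at_point (E' j) p) = 0.
    rewrite /z (nabla_skew Hn p sX (sE _)) Xp.
    rewrite (metric_lcomb bH bV HV ig)//; last exact (t_ p (vE'W j)).
    rewrite (bigD1_ord i0)//= x0 mul0r add0r -sumrN.
    have := congr1 (fun A : 'rV_k.-1 => A 0 j) yB; rewrite !mxE => yB0.
    rewrite -[RHS]yB0; apply: eq_bigr => l _; rewrite xl mxE.
    by rewrite (nabla_skew Hn p (sE _) (sE _)) mulrN.
  have zE0 : g p z (at_point (E i0) p) = 0.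
    have := min_nablaW sX; rewrite -/z (metricC ig tz (t_ p vW)) Ww.
    rewrite (metric_lcomb bH bV HV ig)// (bigD1_ord i0)//= big1 ?addr0.
      move=> /eqP; rewrite mulf_eq0 (negPf w0)/= => /eqP.
      by rewrite (metricC ig).
    by move=> j _; rewrite (metricC ig)// zE' mulr0.
  have zE i : g p z (at_point (E i) p) = 0.
    by case: (unliftP i0 i) => [j|] ->; [exact (zE' j)|].
  apply: (metric_eq0 ig tz); have [c zc] := sp _ (HXW p).
  rewrite [X in g p X _]zc (metric_lcomb bH bV HV ig)// big1// => i _.
  by rewrite (metricC ig)// zE mulr0.
move=> a aXW.
have : lcomb (fun i => a ord0 * x i + a ord_max * w i) (fun i => at_point (E i) p) = \0.
  rewrite -aXW; apply/funext => f; rewrite /lcomb big_ord_recl big_ord1.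
  rewrite (_ : lift ord0 ord0 = ord_max); last exact: val_inj.
  rewrite !(tnth_nth \0)/= Xp Ww /lcomb !mulr_sumr -big_split/=.
  by apply: eq_bigr => i _; rewrite mulrDl !mulrA.
move=> /li aw.
have a1 : a ord_max = 0.
  by have /eqP := aw i0; rewrite x0 mulr0 add0r mulf_eq0 (negPf w0) orbF => /eqP.
have a0 : a ord0 = 0.
  have /rV0Pn[j yj] := y0.
  by have /eqP := aw (lift i0 j); rewrite a1 mul0r addr0 xl mulf_eq0 (negPf yj) orbF => /eqP.
move=> i; case: (unliftP ord0 i) => [j|] ->//; rewrite -[RHS]a1; congr a.
by apply: val_inj; rewrite ord1.
Qed.

End AtMinimum.

End HorizontalKilling.

Theorem lemma5p17 (R : realType) (n k m : nat) (M : manifold R n)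
    (o : set (chart R n M))
    (H V : M -> set (Cinf M -> R))
    (ip g : M -> (Cinf M -> R) -> (Cinf M -> R) -> R)
    (nabla : (Cinf M -> Cinf M) -> (Cinf M -> Cinf M) -> (Cinf M -> Cinf M))
    (M_nonempty : [set: M] !=set0)
    (M_compact : compact [set: M])
    (M_oriented : orientation o)
    (M_sRC : sRC_manifold k m H V ip)
    (g_extends : riemannian_extension H V ip g)
    (nabla_canonical : canonical_connection H V g nabla)
    (M_H_normal : H_normal H V nabla)
    (V_integrable : integrable_distribution m V)
    (H_even : ~~ odd k)
    (H_positive : horizontal_curvature_positive H ip nabla)
    (K : Cinf M -> Cinf M) (K_killing : H_killing H V ip K) :
  exists p : M, bundle_proj H V p (at_point K p) = \0.
Proof.
have [bH _ sip bV HV] := M_sRC; have [ig g_ip gHV] := g_extends.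
have [vK _ _ _] := K_killing.
have [p pmin] := Cinf_min (pairing g (bundle_proj_field H V K) (bundle_proj_field H V K))
  M_nonempty M_compact.
exists p; rewrite -(bundle_proj_fieldE bH bV HV ig gHV p vK).
apply: contrapT => W0.
have [X sX [X0 li]] := kernel_direction bH bV HV g_extends nabla_canonical K_killing
  M_H_normal pmin H_even W0.
have sW := bundle_proj_section bH bV HV ig gHV vK.
have := min_curvature bH bV HV g_extends nabla_canonical K_killing M_H_normal
  V_integrable pmin sX X0.
by rewrite leNgt H_positive.
Qed.
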